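(* In the setting described in the context, suppose $u_k^*=\overline\mu_k^*(\sigma_k)$, $k=0,\dots,N-1$, is optimal in the sense that $\overline\mu_k^*(\sigma)=\arg\sup_{u\in\mathcal U}\mathbb E^{\dag}[V_{k+1}^*(T_{u,y_{k+1}}[\sigma])]$ for all $k$, where $V_N^*(\sigma)=\langle\sigma,{\bf 1}_K\rangle$ and $V_k^*(\sigma)=\sup_{u\in\mathcal U}\mathbb E^{\dag}[V_{k+1}^*(T_{u,y_{k+1}}[\sigma])]$. Then $u_k^*$ is also optimal for the partially observable problem of maximizing $r_K(\pi)$ over $\pi\in\Pi$, and can be written as $u_k^*=\mu_k^*(i_k)=\overline\mu_k^*(\eta_k(\rho,i_k))=\overline\mu_k^*(\sigma_k)$. Moreover, with $\overline\pi^*=(\overline\mu_0^*,\dots,\overline\mu_{N-1}^* )$ and $\pi^*=(\mu_0^*,\dots,\mu_{N-1}^* )$, $$\overline r_K(\overline\pi^* )=\sup_{\pi\in\Pi}r_K(\pi)=r_K(\pi^* ).$$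
   Context: System. $\mathcal Q$ is a finite set of discrete states with $N_q$ elements, $X\subseteq\mathbb R^n$ is the set of continuous states, $\mathcal S=X\times\mathcal Q$ is the hybrid state space with states $s=(x,q)$ (integrals over the continuous state are written over $\mathbb R^n$), and $\mathcal U$ is a compact Borel space of control inputs. The state transition law is $\tau(ds'\mid s,u)=T_x(dx'\mid x,u,q')\,T_q(q'\mid x,q,u)$, where $T_x$ is a Borel-measurable stochastic kernel and $T_q$ a discrete transition kernel; $\tau(x',q'\mid x,q,u)$ denotes the corresponding transition density (with respect to Lebesgue measure in $x'$ times counting measure in $q'$). The initial state $s_0$ has Borel-measurable density $\rho$ on $\mathcal S$. Observations. At times $k\ge1$ one observes $y_k=(y_k^x,y_k^q)\in\mathbb R^n\times\mathcal Q$, conditionally independent given the state, with $y_k^x=h(x_k,u_{k-1})+v_k$, where $h$ is bounded and continuous and the $v_k$ are i.i.d. with positive density $\phi$ on $\mathbb R^n$, and $P[y_k^q=m\mid q_k=q,u_{k-1}=u]=Q_{q,m}(u)$, assumed nowhere zero. Partially observable problem. The information vector is $i_k=(y_1,\dots,y_k,u_0,\dots,u_{k-1})$, with values in $\mathcal I_k$. A policy $\pi=(\mu_0,\dots,\mu_{N-1})\in\Pi$ consists of (non-randomized) functions $\mu_k:\mathcal I_k\to\mathcal U$, with $u_k=\mu_k(i_k)$. It induces, together with $\rho,\tau,\phi,Q$, a probability measure $\mathbb P^\pi$ (expectation $\mathbb E^\pi$) on state and observation trajectories. For a Borel safe set $K\subseteq\mathcal S$ and horizon $N$, $r_K(\pi)=\mathbb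 P^\pi[s_i\in K\ \forall i=0,\dots,N]=\mathbb E^\pi[\prod_{i=0}^N{\bf 1}_K(s_i)]$. Change of measure. $\mathbb P^{\dag}$ (expectation $\mathbb E^{\dag}$) is defined from $\mathbb P^\pi$ by $d\mathbb P^\pi/d\mathbb P^{\dag}=\Lambda_k$ on the $\sigma$-algebra generated by $s_0,\dots,s_k,y_1,\dots,y_k$, where $$\Lambda_k=\prod_{l=1}^k\frac{\phi(y_l^x-h(x_l,u_{l-1}))\,Q_{q_l,y_l^q}(u_{l-1})}{\phi(y_l^x)\,\frac1{N_q}}.$$ Under $\mathbb P^{\dag}$ the $y_k$ are i.i.d. with $y_k^x$ of density $\phi$, $y_k^q$ uniform on $\mathcal Q$, and $y_k^x,y_k^q$ independent. Information state. $\sigma_k=\eta_k(\rho,i_k)$ is the function on $\mathcal S$ which is the unnormalized conditional density $\sigma_k(x,q)=\mathbb E^{\dag}[{\bf 1}_q(q_k){\bf 1}_x(x_k)\prod_{i=0}^{k-1}{\bf 1}_K(s_i)\Lambda_k\mid i_k]$, i.e. $\int_A\sigma_k(x,q)\,dx=\mathbb E^{\dag}[{\bf 1}_{\{q_k=q\}}{\bf 1}_A(x_k)\prod_{i=0}^{k-1}{\bf 1}_K(s_i)\Lambda_k\mid i_k]$ for Borel $A$. It satisfies $\sigma_0=\rho$, $\sigma_{k+1}=T_{u_k,y_{k+1}}[\sigma_k]$, where for $\sigma\in L^1(\mathcal S)$, $y=(y^x,y^q)$, $$T_{u,y}[\sigma](x,q)=\sum_{q^-\in\mathcal Q}N_qQ_{q,y^q}(u)\int_{\mathbb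 R^n}{\bf 1}_K(x^-,q^-)\frac{\phi(y^x-h(x,u))}{\phi(y^x)}\tau(x,q\mid x^-,q^-,u)\sigma(x^-,q^-)\,dx^- .$$ $\Sigma_k$ is the space of information states at time $k$ (nonnegative functions in $L^1(\mathcal S)$). An information-state policy is $\overline\pi=(\overline\mu_0,\dots,\overline\mu_{N-1})$ with functions $\overline\mu_k:\Sigma_k\to\mathcal U$, $u_k=\overline\mu_k(\sigma_k)$, and its cost is $\overline r_K(\overline\pi)=\mathbb E^{\dag}[\langle\sigma_N,{\bf 1}_K\rangle]$, where $\langle\sigma,{\bf 1}_K\rangle=\sum_{q}\int_{\mathbb R^n}\sigma(x,q){\bf 1}_K(x,q)\,dx$. Also $\mathbb E^{\dag}[V(T_{u,y_{k+1}}[\sigma])]=\sum_{y^q\in\mathcal Q}\int_{\mathbb R^n}V(T_{u,(y^x,y^q)}[\sigma])\frac1{N_q}\phi(y^x)\,dy^x$. *)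

(* Defs.v *)
From HB Require Import structures.
From mathcomp Require Import all_boot all_order all_algebra.
From mathcomp Require Import all_classical all_reals all_analysis.
From mathcomp Require Import measurable_realfun.

Set Implicit Arguments.
Unset Strict Implicit.
Unset Printing Implicit Defensive.
Import Order.TTheory GRing.Theory Num.Theory.
Import numFieldNormedType.Exports.

Local Open Scope classical_set_scope.
Local Open Scope ring_scope.

HB.mixin Record isDiscrete (d : measure_display) T & Measurable d T := {
  discrete_measurableP : forall A : set T, measurable A
}.

#[short(type="finDiscreteType")]
HB.structure Definition FinDiscrete d :=
  {T of Finite T & Measurable d T & isDiscrete d T}.

Lemma sigma_finite_counting_fin (R : realType) d (Q : finDiscreteType d) :
  sigma_finite [set: Q] (@counting Q R).
Proof.
exists (fun=> setT); first by rewrite bigcup_const.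
move=> _; split; first exact: measurableT.
by rewrite /counting /= asboolT ?ltry//; exact: finite_finset.
Qed.

HB.instance Definition _ (R : realType) d (Q : finDiscreteType d) :=
  Measure_isSigmaFinite.Build _ _ _ (@counting Q R)
    (sigma_finite_counting_fin R Q).

(* The sigma-algebra on row vectors is the one generated by the coordinates;
   over the reals it is the Borel sigma-algebra. *)
Definition rV_coord {T : Type} {n : nat} (i : 'I_n) (v : 'rV[T]_n) : T :=
  v ord0 i.

HB.instance Definition _ d (T : measurableType d) (n : nat) :=
  @isMeasurable.Build (measure_tuple_display d) 'rV[T]_n
    (g_sigma_preimage (@rV_coord T n))
    (@sigma_algebra0 _ setT _) (@sigma_algebraC 'rV[T]_n _)
    (@sigma_algebra_bigcup _ setT _).

Section mpush.
Context d1 d2 (T1 : measurableType d1) (T2 : measurableType d2) (R : realType).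
Context (m : {sigma_finite_measure set T1 -> \bar R}).
Context (f : T1 -> T2) (g : T2 -> T1).
Context (mf : measurable_fun [set: T1] f) (mg : measurable_fun [set: T2] g).
Context (fK : cancel f g).

(* The proofs are arguments so that the instances below can depend on them. *)
Definition mpush of measurable_fun [set: T1] f & measurable_fun [set: T2] g
  & cancel f g := pushforward m f.
Local Notation mu := (mpush mf mg fK).

Let pm : {measure set T2 -> \bar R} :=
  @measure_function_pushforward__canonical__measure_function_Measure
    _ _ T1 T2 R m f mf.

HB.instance Definition _ := isMeasure.Build _ _ _ mu (measure0 pm)
  (measure_ge0 pm) (@measure_semi_sigma_additive _ _ _ pm).

Lemma sigma_finite_mpush : sigma_finite [set: T2] mu.
Proof.
have [F UF mF] := sigma_finiteT m.
exists (fun i => g @^-1` F i).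
  by rewrite -preimage_bigcup -UF preimage_setT.
move=> i; have [mFi Fi] := mF i; split.
  by rewrite -[X in measurable X]setTI; exact: mg.
rewrite /mpush /pushforward -comp_preimage (_ : g \o f = id) //.
by apply/funext => x /=; rewrite fK.
Qed.

HB.instance Definition _ := Measure_isSigmaFinite.Build _ _ _ mu
  sigma_finite_mpush.

End mpush.

(* Over generic sigma-finite factors the canonical sigma-finite instance of
   [\x] is shadowed by the one for subprobabilities. *)
Section sprod.
Context d1 d2 (T1 : measurableType d1) (T2 : measurableType d2) (R : realType).
Context (m1 : {sigma_finite_measure set T1 -> \bar R}).
Context (m2 : {sigma_finite_measure set T2 -> \bar R}).

Definition sprod : set (T1 * T2) -> \bar R := (m1 \x m2)%E.

Let pm : {measure set (T1 * T2)%type -> \bar R} := (m1 \x m2)%E.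

HB.instance Definition _ := isMeasure.Build _ _ _ sprod (measure0 pm)
  (measure_ge0 pm) (@measure_semi_sigma_additive _ _ _ pm).

Lemma sigma_finite_sprod : sigma_finite [set: T1 * T2] sprod.
Proof.
have /sigma_finiteP[F [TF ndF Foo]] := sigma_finiteT m1.
have /sigma_finiteP[G [TG ndG Goo]] := sigma_finiteT m2.
exists (fun n => F n `*` G n).
  rewrite -setXTT TF TG predeqE => -[x y]; split.
    move=> [/= [n _ Fnx] [k _ Gky]]; exists (maxn n k) => //; split.
    - by move: x Fnx; exact/subsetPset/ndF/leq_maxl.
    - by move: y Gky; exact/subsetPset/ndG/leq_maxr.
  by move=> [n _ []/= ? ?]; split; exists n.
move=> k; have [? ?] := Foo k; have [? ?] := Goo k.
split; first exact: measurableX.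
by rewrite /sprod product_measure1E// lte_mul_pinfty// ge0_fin_numE.
Qed.

HB.instance Definition _ := Measure_isSigmaFinite.Build _ _ _ sprod
  sigma_finite_sprod.

End sprod.

Section power_measure.
Context d (T : measurableType d) (R : realType).

Definition tsnoc n (z : n.-tuple T * T) : n.+1.-tuple T :=
  [tuple of rcons z.1 z.2].

Definition tinit (A : Type) n (t : n.+1.-tuple A) : n.-tuple A :=
  [tuple tnth t (widen_ord (leqnSn n) i) | i < n].

Definition tunsnoc n (t : n.+1.-tuple T) : n.-tuple T * T :=
  (tinit t, tnth t ord_max).

Lemma tnth_rcons_widen (A : Type) n (t : n.-tuple A) (x : A) (i : 'I_n) :
  tnth [tuple of rcons t x] (widen_ord (leqnSn n) i) = tnth t i.
Proof.
rewrite (tnth_nth x) (tnth_nth x) /= nth_rcons size_tuple.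
by case: i => i /= ->.
Qed.

Lemma tnth_rcons_max (A : Type) n (t : n.-tuple A) (x : A) :
  tnth [tuple of rcons t x] ord_max = x.
Proof. by rewrite (tnth_nth x) /= nth_rcons size_tuple ltnn eqxx. Qed.

Lemma tsnocK n : cancel (@tsnoc n) (@tunsnoc n).
Proof.
move=> [t x]; rewrite /tunsnoc /tsnoc /=; congr pair.
  apply: eq_from_tnth => i; rewrite tnth_mktuple.
  exact: (tnth_rcons_widen t x i).
exact: (tnth_rcons_max t x).
Qed.

Lemma measurable_tsnoc n : measurable_fun [set: n.-tuple T * T] (@tsnoc n).
Proof.
apply/measurable_fun_tnthP => i.
have [ltin|] := ltnP i n.
  rewrite (_ : _ \o _ = (@tnth n T ^~ (Ordinal ltin)) \o fst).
    apply: measurableT_comp; last exact: measurable_fst.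
    exact: measurable_tnth.
  apply/funext => z /=; rewrite -(tnth_rcons_widen z.1 z.2).
  by congr tnth; exact: val_inj.
move=> leni; rewrite (_ : _ \o _ = snd); first exact: measurable_snd.
apply/funext => z /=; rewrite -[RHS](tnth_rcons_max z.1 z.2).
congr tnth; apply: val_inj => /=; apply/eqP; rewrite eqn_leq leni andbT.
by rewrite -ltnS.
Qed.

Lemma measurable_tunsnoc n :
  measurable_fun [set: n.+1.-tuple T] (@tunsnoc n).
Proof.
apply/measurable_fun_pairP; split => /=; last exact: measurable_tnth.
apply/measurable_fun_tnthP => i.
rewrite (_ : _ \o _ = @tnth n.+1 T ^~ (widen_ord (leqnSn n) i)).
  exact: measurable_tnth.
by apply/funext => t /=; rewrite tnth_mktuple.
Qed.

(* [mpow mu n] is the n-fold product measure mu x ... x mu *)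
Fixpoint mpow (mu : {sigma_finite_measure set T -> \bar R}) (n : nat) :
    {sigma_finite_measure set (n.-tuple T) -> \bar R} :=
  match n with
  | 0 => dirac ([tuple] : 0.-tuple T)
  | n'.+1 =>
    mpush (sprod (mpow mu n') mu) (@measurable_tsnoc n') (@measurable_tunsnoc n') (@tsnocK n')
  end.

End power_measure.

Section lebesgue_rV.
Context (R : realType) (n : nat).

Definition rV_of_tuple (t : n.-tuple R) : 'rV[R]_n := \row_i tnth t i.
Definition tuple_of_rV (v : 'rV[R]_n) : n.-tuple R := [tuple v ord0 i | i < n].

Lemma rV_of_tupleK : cancel rV_of_tuple tuple_of_rV.
Proof.
by move=> t; apply: eq_from_tnth => i; rewrite tnth_mktuple mxE.
Qed.

Lemma measurable_tuple_of_rV : measurable_fun [set: 'rV[R]_n] tuple_of_rV.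
Proof.
apply/measurable_fun_tnthP => i _ A mA; rewrite setTI.
apply: sub_sigma_algebra; rewrite -bigcup_seq/=; exists i => /=.
  by rewrite mem_index_enum.
exists A => //; rewrite setTI; apply/funext => v /=.
by rewrite tnth_mktuple.
Qed.

Lemma measurable_rV_of_tuple : measurable_fun [set: n.-tuple R] rV_of_tuple.
Proof.
move=> _ A mA; rewrite setTI.
have : preimage_set_system [set: n.-tuple R] rV_of_tuple
         (g_sigma_preimage (@rV_coord R n)) (rV_of_tuple @^-1` A).
  by exists A => //; rewrite setTI.
rewrite -g_sigma_preimage_comp /=.
rewrite (_ : (fun i => _) = (fun i => @tnth n R ^~ i)) //.
by apply/funext => i; apply/funext => t /=; rewrite /rV_coord mxE.
Qed.

Definition lebesgue_rV : {sigma_finite_measure set 'rV[R]_n -> \bar R} :=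
  mpush (mpow (@lebesgue_measure R) n) measurable_rV_of_tuple
    measurable_tuple_of_rV rV_of_tupleK.

End lebesgue_rV.

Notation borel U := (g_sigma_algebraType (@open U)).

Section hybrid_system.
Context (R : realType) (n : nat) (dQ : measure_display).
Context (Q : finDiscreteType dQ) (U : pseudoPMetricType R).

Local Notation Rn := 'rV[R]_n.
Local Notation S := (Rn * Q)%type.
Local Notation UB := (borel U).
Local Notation leb := (lebesgue_rV R n).

(* Densities and kernels are extended to the whole of R^n: [init_dens] and
   [trans_dens] vanish off [cspace], while [Tx], [trans_dens] and [obs] are
   arbitrary when the source state lies off [cspace]. *)
Record hybrid_system := HybridSystem {
  cspace : set Rn ;
  safe : set S ;
  (* [Tx (x, (u, q'))] is T_x(dx' | x, u, q') *)
  Tx : R.-pker (Rn * (UB * Q)) ~> Rn ;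
  Tq : R.-pker (S * UB) ~> Q ;
  (* [trans_dens s' s u] is tau(s' | s, u) *)
  trans_dens : S -> S -> U -> R ;
  init_dens : S -> R ;
  obs : Rn * U -> Rn ;
  noise : Rn -> R ;
  (* [confusion q m u] is the probability of observing m in mode q *)
  confusion : Q -> Q -> U -> R ;

  measurable_cspace : measurable cspace ;
  measurable_safe : measurable safe ;
  safe_sub : forall s, safe s -> cspace s.1 ;

  Tx_cspace : forall x u q', cspace x -> Tx (x, (u, q')) (~` cspace) = 0%E ;
  trans_dens_ge0 : forall s' s u, 0 <= trans_dens s' s u ;
  trans_dens_out : forall s' s u, ~ cspace s'.1 -> trans_dens s' s u = 0 ;
  measurable_trans_dens : measurable_fun [set: S * (S * UB)]
    (fun z => trans_dens z.1 z.2.1 z.2.2) ;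
  trans_densE : forall (x : Rn) (q : Q) (u : U) (q' : Q) (A : set Rn),
    cspace x -> measurable A ->
    (\int[leb]_(x' in A) (trans_dens (x', q') (x, q) u)%:E =
     Tx (x, (u, q')) A * Tq ((x, q), u) [set q'])%E ;

  init_dens_ge0 : forall s, 0 <= init_dens s ;
  init_dens_out : forall s, ~ cspace s.1 -> init_dens s = 0 ;
  measurable_init_dens : measurable_fun [set: S] init_dens ;
  init_dens_int : (\sum_(q : Q) \int[leb]_x (init_dens (x, q))%:E = 1)%E ;

  obs_continuous : {within cspace `*` [set: U], continuous obs} ;
  obs_bounded : exists M : R, forall x u, cspace x -> `|obs (x, u)| <= M ;

  noise_gt0 : forall v, 0 < noise v ;
  measurable_noise : measurable_fun [set: Rn] noise ;
  noise_int : (\int[leb]_v (noise v)%:E = 1)%E ;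

  confusion_gt0 : forall q m u, 0 < confusion q m u ;
  confusion_sum : forall q u, \sum_(m : Q) confusion q m u = 1 ;
  measurable_confusion : forall q m,
    measurable_fun [set: UB] (confusion q m : UB -> R)
}.

Variable H : hybrid_system.

Local Notation K := (safe H).
Local Notation tau := (trans_dens H).
Local Notation rho := (init_dens H).
Local Notation h := (obs H).
Local Notation phi := (noise H).
Local Notation Qc := (confusion H).
Local Notation Nq := (#|Q|%:R : R).

(* A pair (y_1, ..., y_k), (u_0, ..., u_(k-1)) *)
Definition info (k : nat) : Type := (k.-tuple S * k.-tuple U)%type.

(* Only the components of index smaller than the horizon are relevant. *)
Definition policy := forall k, info k -> U.

Definition admissible (N : nat) (mu : policy) := forall k, (k < N)%N ->
  measurable_fun [set: k.-tuple S * k.-tuple UB] (mu k : _ -> UB).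

Fixpoint controls (mu : policy) (k : nat) : k.-tuple S -> k.-tuple U :=
  match k with
  | 0 => fun=> [tuple]
  | k'.+1 => fun ys =>
      let us := controls mu (tinit ys) in
      [tuple of rcons us (mu k' (tinit ys, us))]
  end.

(* States s_0, ..., s_k and observations y_1, ..., y_k *)
Definition traj (k : nat) : Type := (k.+1.-tuple S * k.-tuple S)%type.

Definition traj_measure (k : nat) :
    {sigma_finite_measure set (k.+1.-tuple S * k.-tuple S)%type -> \bar R} :=
  sprod (mpow (sprod leb (@counting Q R)) k.+1)
        (mpow (sprod leb (@counting Q R)) k).

(* The joint density of (s_0, ..., s_k, y_1, ..., y_k) under controls
   u_0, ..., u_(k-1), and the likelihood ratio Lambda_k; with l counted from 0,
   [tnth ss (lift ord0 l)] is s_(l+1) and [tnth ys l] is y_(l+1). *)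
Definition traj_dens (k : nat) (us : k.-tuple U) (w : traj k) : R :=
  let: (ss, ys) := w in
  rho (tnth ss ord0) *
  \prod_(l < k)
    (let s := tnth ss (widen_ord (leqnSn k) l) in
     let s' := tnth ss (lift ord0 l) in
     let y := tnth ys l in
     let u := tnth us l in
     tau s' s u * (phi (y.1 - h (s'.1, u)) * Qc s'.2 y.2 u)).

Definition likelihood (k : nat) (us : k.-tuple U) (w : traj k) : R :=
  let: (ss, ys) := w in
  \prod_(l < k)
    (let s' := tnth ss (lift ord0 l) in
     let y := tnth ys l in
     let u := tnth us l in
     (phi (y.1 - h (s'.1, u)) * Qc s'.2 y.2 u) / (phi y.1 * Nq^-1)).

(* The law P and the expectation under the reference law P^dag, of density
   1 / Lambda_k with respect to P, when the controls are the function [c] of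
   the observations. *)
Definition traj_prob (k : nat) (c : k.-tuple S -> k.-tuple U)
    (A : set (traj k)) : \bar R :=
  \int[traj_measure k]_(w in A) (traj_dens (c w.2) w)%:E.

Definition ref_expectation (k : nat) (c : k.-tuple S -> k.-tuple U)
    (f : traj k -> \bar R) : \bar R :=
  (\int[traj_measure k]_w
     (f w * (traj_dens (c w.2) w / likelihood (c w.2) w)%:E))%E.

Definition safety (N : nat) (mu : policy) : \bar R :=
  traj_prob (controls mu (k := N)) [set w | forall i, K (tnth w.1 i)].

(* Values in \bar R, as the integral in [is_update] can be infinite on a null
   set. *)
Definition isfun : Type := S -> \bar R.

Definition info_states : set isfun :=
  [set sigma | (forall s, 0 <= sigma s)%E /\
     (sprod leb (@counting Q R)).-integrable [set: S] sigma].

Definition pairing (sigma : isfun) (A : set S) : \bar R :=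
  (\sum_(q : Q) \int[leb]_x (sigma (x, q) * (\1_A (x, q))%:E))%E.

Definition is_update (u : U) (y : S) (sigma : isfun) : isfun := fun s =>
  (\sum_(q : Q) (Nq * Qc s.2 y.2 u)%:E *
     \int[leb]_x ((\1_K (x, q) * (phi (y.1 - h (s.1, u)) / phi y.1)
                   * tau s (x, q) u)%:E * sigma (x, q)))%E.

Definition eta (k : nat) (i : info k) : isfun :=
  foldl (fun sigma yu => is_update yu.2 yu.1 sigma) (fun s => (rho s)%:E)
    (zip i.1 i.2).

(* E^dag[V(T_{u,y}[sigma])] *)
Definition ref_step (V : isfun -> \bar R) (u : U) (sigma : isfun) : \bar R :=
  (\sum_(m : Q) \int[leb]_y
     (V (is_update u (y, m) sigma) * (Nq^-1 * phi y)%:E))%E.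

Fixpoint value_to_go (j : nat) : isfun -> \bar R :=
  match j with
  | 0 => pairing ^~ K
  | j'.+1 => fun sigma =>
      ereal_sup (range (fun u => ref_step (value_to_go j') u sigma))
  end.

Definition opt_value (N k : nat) : isfun -> \bar R := value_to_go (N - k).

(* The sigma-algebra on functions generated by the evaluations
   sigma |-> \int_A sigma(x, q) dx; on nonnegative elements of L^1 it is the
   Borel sigma-algebra of the L^1 norm. *)
Definition isfun_gen : set (set isfun) :=
  [set E | exists (q : Q) (A : set Rn) (B : set (\bar R)),
     [/\ measurable A, measurable B &
         E = [set sigma | B (\int[leb]_(x in A) sigma (x, q))%E]]].

Definition is_policy := nat -> isfun -> U.

Definition is_admissible (N : nat) (mub : is_policy) :=
  forall k, (k < N)%N ->
  measurable_fun [set: g_sigma_algebraType isfun_gen]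
    (mub k : g_sigma_algebraType isfun_gen -> UB).

(* The information state sigma_k and the controls u_0, ..., u_(k-1) under
   u_j = mub_j(sigma_j). *)
Fixpoint closed_loop (mub : is_policy) (k : nat) :
    k.-tuple S -> isfun * k.-tuple U :=
  match k with
  | 0 => fun=> (fun s => (rho s)%:E, [tuple])
  | k'.+1 => fun ys =>
      let: (sigma, us) := closed_loop mub (tinit ys) in
      let u := mub k' sigma in
      (is_update u (tnth ys ord_max) sigma, [tuple of rcons us u])
  end.

Definition is_safety (N : nat) (mub : is_policy) : \bar R :=
  ref_expectation (fun ys => (closed_loop mub (k := N) ys).2)
    (fun w => pairing (closed_loop mub w.2).1 K).

Definition policy_of (mub : is_policy) : policy := fun k i => mub k (eta i).

(* [sigma] is a version of the unnormalized conditional density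
   E^dag[1_q(q_k) 1_x(x_k) \prod_(i < k) 1_K(s_i) Lambda_k | i_k]. *)
Definition unnormalized_cond_density (mu : policy) (k : nat)
    (sigma : info k -> isfun) :=
  let c := controls mu (k := k) in
  forall (q : Q) (A : set Rn), measurable A ->
  measurable_fun [set: k.-tuple S * k.-tuple UB]
    (fun i => \int[leb]_(x in A) sigma i (x, q))%E /\
  forall B : set (k.-tuple S * k.-tuple UB), measurable B ->
  ref_expectation c (fun w => ((\1_B (w.2, c w.2))%:E *
      \int[leb]_(x in A) sigma (w.2, c w.2) (x, q))%E) =
  ref_expectation c (fun w =>
     (\1_B (w.2, c w.2) *
      (((tnth w.1 ord_max).2 == q)%:R * \1_A (tnth w.1 ord_max).1 *
       (\prod_(i < k) \1_K (tnth w.1 (widen_ord (leqnSn k) i))) *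
       likelihood (c w.2) w))%:E).

End hybrid_system.

Arguments isfun R n {dQ} Q.
Arguments eta {R n dQ Q U} H k i.

(* Main.v *)
Require Import Defs.
From mathcomp Require Import all_boot all_order all_algebra.
From mathcomp Require Import all_classical all_reals all_analysis.
From mathcomp Require Import measurable_realfun ring.

Set Implicit Arguments.
Unset Strict Implicit.
Unset Printing Implicit Defensive.
Import Order.TTheory GRing.Theory Num.Theory.
Import numFieldNormedType.Exports.

Local Open Scope classical_set_scope.
Local Open Scope ring_scope.

(* Integrating the joint density of states and observations over the states
   unrolls into the filter recursion, so that for every policy the safety
   probability is E^dag <sigma_N, 1_K>. Integrating one update of an information
   state over the observation (by translation invariance, the noise density
   integrates to 1 whatever the state) does not increase its mass; hence almost
   surely all sigma_k are integrable and the argsup hypothesis applies to them.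
   On integrable states V_k^* therefore coincides with the value of the policy
   mub from time k on, which, unlike a supremum over uncountably many controls,
   is visibly measurable. Dynamic programming then says that E^dag V_k^*(sigma_k)
   decreases in k along any policy and is constant along mub, which compares the
   safety of any policy with V_0^*(rho). *)

(** * Product measures and integrals *)

(** Two obstacles shape the development. The value functions are suprema over an arbitrary set of
    controls and need not be measurable, while the argsup hypothesis is available at integrable
    information states only; so the comparison with the value of [mub] holds almost everywhere,
    between a possibly non-measurable function and a measurable one, and the integral has to respect
    it. Moreover, the controls depend on the observations: trajectory integrals are therefore taken
    with the observations outermost, so that inside them the control sequence is constant and
    Tonelli applies to each time step. Densities stay relative to Lebesgue times counting measure
    throughout. Multiplying an update by the reference density of its observation cancels the
    denominator of the likelihood ratio, which turns expectations under the reference law into plain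
    integrals of the joint density. *)

Section tonelli.
Local Open Scope ereal_scope.
Context d1 d2 (T1 : measurableType d1) (T2 : measurableType d2) (R : realType).
Context (m1 : {sigma_finite_measure set T1 -> \bar R}).
Context (m2 : {sigma_finite_measure set T2 -> \bar R}).

Lemma measurable_int_param (f : T1 -> T2 -> \bar R) :
  measurable_fun [set: T1 * T2] (fun z => f z.1 z.2) ->
  (forall x y, 0 <= f x y) ->
  measurable_fun [set: T1] (fun x => \int[m2]_y f x y).
Proof.
move=> mf f0.
exact: (measurable_fun_fubini_tonelli_F (fun z => f z.1 z.2) mf).
Qed.

Lemma integral_sprod (f : T1 * T2 -> \bar R) :
  measurable_fun [set: T1 * T2] f -> (forall z, 0 <= f z) ->
  \int[sprod m1 m2]_z f z = \int[m1]_x \int[m2]_y f (x, y).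
Proof. exact: fubini_tonelli1. Qed.

Lemma integral_swap (f : T1 -> T2 -> \bar R) :
  measurable_fun [set: T1 * T2] (fun z => f z.1 z.2) ->
  (forall x y, 0 <= f x y) ->
  \int[m1]_x \int[m2]_y f x y = \int[m2]_y \int[m1]_x f x y.
Proof.
move=> mf f0.
exact: (fubini_tonelli (m1 := m1) (m2 := m2) (fun z => f z.1 z.2) mf).
Qed.

End tonelli.

Section lower_integral.
Local Open Scope ereal_scope.
Context d (T : measurableType d) (R : realType).
Context (mu : {measure set T -> \bar R}).

Import HBNNSimple.

(** The integral of a nonnegative function is a supremum over the simple functions below it, and
    every simple function below [f] is below [g]; measurability does not enter. *)
Lemma ge0_le_integral_nonmeas (f g : T -> \bar R) :
  (forall x, 0 <= f x) -> (forall x, f x <= g x) ->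
  \int[mu]_x f x <= \int[mu]_x g x.
Proof.
move=> f0 fg; have g0 x : 0 <= g x by exact: le_trans (fg x).
rewrite !ge0_integralTE//; apply: le_ereal_sup => _ [h /= hf <-].
by exists h => // x; exact: le_trans (fg x).
Qed.

(* The integral of a non-negative function is a supremum over simple
   functions, so that it ignores null sets even for non-measurable functions;
   the value functions of the dynamic programme need not be measurable. *)
Lemma ge0_integral_ae_nonmeas (f g : T -> \bar R) :
  (forall x, 0 <= f x) -> (forall x, 0 <= g x) -> measurable_fun setT g ->
  {ae mu, forall x, f x = g x} ->
  \int[mu]_x f x = \int[mu]_x g x.
Proof.
move=> f0 g0 mg [N [mN N0 fgN]].
have fg x : ~ N x -> f x = g x by move=> Nx; apply: contra_notP Nx => /fgN.
apply/eqP; rewrite eq_le; apply/andP; split.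
  rewrite ge0_integralTE//; apply: ge_ereal_sup => _ [h /= hf <-].
  rewrite -integralT_nnsfun; apply: ae_ge0_le_integral => //.
  - by move=> x _; rewrite lee_fin; exact: fun_ge0.
  - exact/measurable_EFinP/measurable_funP.
  - exists N; split=> // x /=; apply: contra_notP => Nx _.
    by rewrite -fg.
(* Conversely, cutting [g] off on [N] keeps its integral, as [g] is measurable, and the function so
   obtained lies below [f] everywhere. *)
rewrite (ge0_negligible_integral mN measurableT mg)// integral_mkcond.
apply: ge0_le_integral_nonmeas => x.
  by rewrite patchE; case: ifP.
rewrite patchE; case: ifPn => // /set_mem [_ Nx].
by rewrite fg.
Qed.

End lower_integral.

Section tuple_snoc.

Lemma tsnoc_widen d (T : measurableType d) k (t : k.-tuple T) (x : T)
    (i : 'I_k) :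
  tnth (tsnoc (t, x)) (widen_ord (leqnSn k) i) = tnth t i.
Proof. exact: tnth_rcons_widen. Qed.

Lemma tsnoc_max d (T : measurableType d) k (t : k.-tuple T) (x : T) :
  tnth (tsnoc (t, x)) ord_max = x.
Proof. exact: tnth_rcons_max. Qed.

Lemma tinit_tsnoc d (T : measurableType d) k (t : k.-tuple T) (x : T) :
  tinit (tsnoc (t, x)) = t.
Proof. by have [] := tsnocK (t, x). Qed.

Lemma tsnoc_ord0 d (T : measurableType d) k (t : k.+1.-tuple T) (x : T) :
  tnth (tsnoc (t, x)) ord0 = tnth t ord0.
Proof. by rewrite -(tsnoc_widen t x); congr tnth; exact: val_inj. Qed.

(** Reindexing for the products over time steps: appending a state leaves the endpoints of the
    earlier steps in place, and the new last step ends at the appended state. *)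
Lemma lift0_widen k (l : 'I_k) :
  lift ord0 (widen_ord (leqnSn k) l) = widen_ord (leqnSn k.+1) (lift ord0 l).
Proof. exact: val_inj. Qed.

Lemma lift0_max k : lift ord0 (ord_max : 'I_k.+1) = ord_max.
Proof. exact: val_inj. Qed.

Lemma tunsnocK d (T : measurableType d) n : cancel (@tunsnoc _ T n) (@tsnoc _ T n).
Proof.
move=> t; apply: eq_from_tnth => i; rewrite /tsnoc /tunsnoc /=.
have [ltin|leni] := ltnP i n.
  have -> : i = widen_ord (leqnSn n) (Ordinal ltin) by exact: val_inj.
  by rewrite tnth_rcons_widen tnth_mktuple.
have -> : i = ord_max.
  by apply: val_inj; apply/eqP; rewrite eqn_leq leni -ltnS ltn_ord.
by rewrite tnth_rcons_max.
Qed.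

End tuple_snoc.

Section mpow_integral.
Local Open Scope ereal_scope.
Context (R : realType).

Lemma ge0_integral_mpush d1 d2 (T1 : measurableType d1)
    (T2 : measurableType d2) (m : {sigma_finite_measure set T1 -> \bar R})
    (f : T1 -> T2) (g : T2 -> T1) (mf : measurable_fun [set: T1] f)
    (mg : measurable_fun [set: T2] g) (fK : cancel f g) (h : T2 -> \bar R) :
  measurable_fun [set: T2] h -> (forall x, 0 <= h x) ->
  \int[mpush m mf mg fK]_x h x = \int[m]_x h (f x).
Proof.
by move=> mh h0; rewrite ge0_integral_pushforward.
Qed.

Context d (T : measurableType d).
Context (mu : {sigma_finite_measure set T -> \bar R}).

Lemma integral_mpow0 (f : 0.-tuple T -> \bar R) :
  measurable_fun setT f -> \int[mpow mu 0]_t f t = f [tuple].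
Proof. by move=> mf; rewrite integral_dirac// diracT mul1e. Qed.

Lemma integral_mpowS n (f : n.+1.-tuple T -> \bar R) :
  measurable_fun setT f -> (forall x, 0 <= f x) ->
  \int[mpow mu n.+1]_t f t = \int[mpow mu n]_t \int[mu]_x f (tsnoc (t, x)).
Proof.
move=> mf f0; rewrite ge0_integral_mpush// integral_sprod//.
by apply: measurableT_comp => //; exact: measurable_tsnoc.
Qed.

Lemma integral_mpow1 (f : 1.-tuple T -> \bar R) :
  measurable_fun setT f -> (forall x, 0 <= f x) ->
  \int[mpow mu 1]_t f t = \int[mu]_s f (tsnoc ([tuple], s)).
Proof.
move=> mf f0; rewrite integral_mpowS// integral_mpow0//.
rewrite (_ : (fun _ => _) = cst (\int[mu]_s f (tsnoc ([tuple], s))))//.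
by apply/funext => t; rewrite (tuple0 t).
Qed.

End mpow_integral.

Section finite_discrete.
Context (R : realType) d (Q : finDiscreteType d).

Lemma measurable_discrete d' (T : measurableType d') (f : Q -> T) :
  measurable_fun [set: Q] f.
Proof. by move=> _ Y _; exact: discrete_measurableP. Qed.

(** A preimage is the union of its slices over the finitely many modes, each a rectangle with a
    singleton side. *)
Lemma measurable_fun_prod_discrete d1 d2 (T1 : measurableType d1)
    (T2 : measurableType d2) (f : T1 * Q -> T2) :
  (forall q, measurable_fun [set: T1] (fun x => f (x, q))) ->
  measurable_fun [set: T1 * Q] f.
Proof.
move=> mf _ Y mY; rewrite setTI.
have -> : f @^-1` Y =
    \bigcup_(q in [set: Q]) ((fun x => f (x, q)) @^-1` Y `*` [set q]).
  apply/seteqP; split=> [[x q] /= fY|[x q] [_ _ [/= fY ->]]//].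
  by exists q.
apply: fin_bigcup_measurable => [|q _].
  by exact: finite_finset.
apply: measurableX; last exact: discrete_measurableP.
by rewrite -[X in measurable X]setTI; exact: mf.
Qed.

Local Open Scope ereal_scope.

Lemma ge0_integral_discrete (m : {measure set Q -> \bar R})
    (f : Q -> \bar R) : (forall q, 0 <= f q) ->
  \int[m]_q f q = \sum_(q : Q) f q * m [set q].
Proof.
move=> f0.
have -> : [set: Q] = \big[setU/set0]_(q <- enum Q) [set q].
  by apply/seteqP; split=> // q _; rewrite -bigcup_seq; exists q => //=;
    rewrite mem_enum.
rewrite ge0_integral_bigsetU//.
- rewrite big_enum; apply: eq_bigr => q _.
  rewrite (eq_integral (cst (f q))) => [|x /set_mem ->//].
  by rewrite integral_cst//; exact: discrete_measurableP.
- by move=> q; exact: discrete_measurableP.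
- exact: enum_uniq.
- by move=> i j _ _ [x [-> ->]].
- by apply: measurable_funTS; exact: measurable_discrete.
Qed.

Lemma measure_discrete (m : {measure set Q -> \bar R}) :
  m [set: Q] = \sum_(q : Q) m [set q].
Proof.
transitivity (\int[m]_q (cst 1 q)); first by rewrite integral_cst// mul1e.
by rewrite ge0_integral_discrete//; apply: eq_bigr => q _; rewrite mul1e.
Qed.

Lemma ge0_integral_counting (f : Q -> \bar R) : (forall q, 0 <= f q) ->
  \int[@counting Q R]_q f q = \sum_(q : Q) f q.
Proof.
move=> f0; rewrite ge0_integral_discrete//; apply: eq_bigr => q _.
have c1 : @counting Q R [set q] = 1.
  by rewrite /counting asboolT// fset_set1 finmap.cardfs1.
by rewrite [X in _ * X]c1 mule1.
Qed.

Lemma integral_sprod_counting d' (T : measurableType d')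
    (m : {sigma_finite_measure set T -> \bar R}) (f : T * Q -> \bar R) :
  measurable_fun [set: T * Q] f -> (forall z, 0 <= f z) ->
  \int[sprod m (@counting Q R)]_z f z = \sum_(q : Q) \int[m]_x f (x, q).
Proof.
move=> mf f0; rewrite integral_sprod//.
rewrite integral_swap//; last by apply: eq_measurable_fun mf => -[].
by rewrite ge0_integral_counting// => q; exact: integral_ge0.
Qed.

End finite_discrete.

(** * Lebesgue measure and Borel sets of row vectors *)

Section row_vectors.
Context (R : realType).

Lemma measurable_rV_coord n (i : 'I_n) :
  measurable_fun [set: 'rV[R]_n] (fun v : 'rV[R]_n => v ord0 i).
Proof.
move=> _ A mA; rewrite setTI; apply: sub_sigma_algebra.
rewrite -bigcup_seq/=; exists i => /=; first by rewrite mem_index_enum.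
by exists A => //; rewrite setTI.
Qed.

Lemma measurable_fun_rV d (T : measurableType d) n (f : T -> 'rV[R]_n) :
  (forall i, measurable_fun [set: T] (fun x => f x ord0 i)) ->
  measurable_fun [set: T] f.
Proof.
move=> mf; have -> : f = @rV_of_tuple R n \o (@tuple_of_rV R n \o f).
  apply/funext => x /=; apply/rowP => i.
  by rewrite mxE tnth_mktuple.
apply: measurableT_comp; first exact: measurable_rV_of_tuple.
apply/measurable_fun_tnthP => i.
by rewrite (_ : _ \o _ = fun x => f x ord0 i)//; apply/funext => x /=;
  rewrite tnth_mktuple.
Qed.

Lemma measurable_rVB d (T : measurableType d) n (f g : T -> 'rV[R]_n) :
  measurable_fun [set: T] f -> measurable_fun [set: T] g ->
  measurable_fun [set: T] (fun x => f x - g x).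
Proof.
move=> mf mg; apply: measurable_fun_rV => i.
rewrite (_ : (fun _ => _) = (fun x => f x ord0 i - g x ord0 i)); last first.
  by apply/funext => x; rewrite !mxE.
apply: measurable_funB.
- exact: measurableT_comp (measurable_rV_coord i) mf.
- exact: measurableT_comp (measurable_rV_coord i) mg.
Qed.

Local Open Scope ereal_scope.

(** The image of Lebesgue measure under a translation gives half-open intervals their length, so it
    is Lebesgue measure by uniqueness. *)
Lemma ge0_integral_lebesgueB (c : R) (f : measurableTypeR R -> \bar R) :
  measurable_fun setT f -> (forall x, 0 <= f x) ->
  \int[@lebesgue_measure R]_x f (x - c)%R = \int[@lebesgue_measure R]_x f x.
Proof.
move=> mf f0.
have mB : measurable_fun [set: measurableTypeR R]
    (fun x : measurableTypeR R => (x - c)%R : measurableTypeR R).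
  by apply: measurable_funB.
rewrite -[LHS](ge0_integral_pushforward mB (@lebesgue_measure R)
  measurableT mf)//.
pose pm : {measure set (measurableTypeR R) -> \bar R} :=
  @measure_function_pushforward__canonical__measure_function_Measure
    _ _ _ _ R (@lebesgue_measure R) _ mB.
apply: (eq_measure_integral (@lebesgue_measure R)) => A mA _.
apply/esym; apply: (@lebesgue_measure_unique R pm) => // X [[a b] /= _ <-].
rewrite /pm /= /pushforward.
have -> : (fun x : R => x - c)%R @^-1` [set` `]a, b]%R] =
    [set` `]a + c, b + c]%R]%R.
  by apply/seteqP; split=> x /=; rewrite !in_itv/= ltrBrDr lerBlDr.
rewrite !lebesgue_measure_itv/= !lte_fin ltrD2r.
by case: ifP => // _; rewrite -!EFinB opprD addrACA subrr addr0.
Qed.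

Definition tuple_sub n (t c : n.-tuple R) : n.-tuple R :=
  [tuple tnth t i - tnth c i | i < n]%R.

Lemma measurable_tuple_sub n (c : n.-tuple R) :
  measurable_fun setT (fun t : n.-tuple R => tuple_sub t c).
Proof.
apply/measurable_fun_tnthP => i.
rewrite (_ : _ \o _ = fun t => (tnth t i - tnth c i)%R); last first.
  by apply/funext => t /=; rewrite tnth_mktuple.
by apply: measurable_funB => //; exact: measurable_tnth.
Qed.

Lemma tuple_sub_tsnoc n (t : n.-tuple R) x (c : n.+1.-tuple R) :
  tuple_sub (tsnoc (t, x)) c =
  tsnoc (tuple_sub t (tinit c), (x - tnth c ord_max)%R).
Proof.
apply: eq_from_tnth => i; rewrite tnth_mktuple /tsnoc /=.
have [ltin|leni] := ltnP i n.
  have -> : i = widen_ord (leqnSn n) (Ordinal ltin) by exact: val_inj.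
  by rewrite !tnth_rcons_widen !tnth_mktuple.
have -> : i = ord_max.
  by apply: val_inj; apply/eqP; rewrite eqn_leq leni -ltnS ltn_ord.
by rewrite !tnth_rcons_max.
Qed.

Lemma ge0_integral_mpow_lebesgueB n (c : n.-tuple R)
    (f : n.-tuple (measurableTypeR R) -> \bar R) :
  measurable_fun setT f -> (forall x, 0 <= f x) ->
  \int[mpow (@lebesgue_measure R) n]_t f (tuple_sub t c) =
  \int[mpow (@lebesgue_measure R) n]_t f t.
Proof.
move=> mf f0; elim: n c f mf f0 => [|n IH] c f mf f0.
  rewrite !integral_mpow0//; last first.
    exact: measurableT_comp (measurable_tuple_sub c).
  by congr f; apply: eq_from_tnth => -[].
have mfs : measurable_fun setT (fun z => f (tsnoc z)).
  exact: measurableT_comp (@measurable_tsnoc _ _ _).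
rewrite !integral_mpowS//; last exact: measurableT_comp (measurable_tuple_sub c).
have mF : measurable_fun setT (fun t => \int[lebesgue_measure]_x f (tsnoc (t, x))).
  by apply: (measurable_int_param (@lebesgue_measure R)
    (f := fun t x => f (tsnoc (t, x)))).
(* Used from right to left on the function already integrated over the last coordinate: it shifts
   the other coordinates, and only the one-dimensional shift remains. *)
rewrite -(IH (tinit c) _ mF); last by move=> t; exact: integral_ge0.
apply: eq_integral => t _.
under eq_integral do rewrite tuple_sub_tsnoc.
rewrite (ge0_integral_lebesgueB _ (f := fun x => f (tsnoc (_, x))))//.
by apply: measurableT_comp mfs _; exact: measurable_fun_pair.
Qed.

Lemma ge0_integral_lebesgue_rVB n (c : 'rV[R]_n) (f : 'rV[R]_n -> \bar R) :
  measurable_fun setT f -> (forall x, 0 <= f x) ->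
  \int[lebesgue_rV R n]_v f (v - c)%R = \int[lebesgue_rV R n]_v f v.
Proof.
move=> mf f0; rewrite [RHS]ge0_integral_mpush//.
rewrite [LHS]ge0_integral_mpush//; last first.
  by apply: measurableT_comp mf _; apply: measurable_rVB.
rewrite -[RHS](@ge0_integral_mpow_lebesgueB _ (tuple_of_rV c)
  (f \o @rV_of_tuple R n)); last 2 first.
- by apply: measurableT_comp mf _; exact: measurable_rV_of_tuple.
- by move=> t /=.
apply: eq_integral => t _; rewrite /=; congr f; apply/rowP => i.
by rewrite !mxE !tnth_mktuple.
Qed.

End row_vectors.

Section borel_product.
Context (R : realType) (n : nat) (U : pseudoPMetricType R).
Local Notation Rn := 'rV[R]_n.
Local Notation UB := (g_sigma_algebraType (@open U)).

(** For the sup metric a ball is a finite intersection of coordinate strips. *)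
Lemma measurable_rV_ball (c : Rn) (e : R) : 0 < e -> measurable (ball c e).
Proof.
move=> e0.
have -> : ball c e =
    \bigcap_(i in [set: 'I_n]) [set v : Rn | ball (c ord0 i) e (v ord0 i)].
  apply/seteqP; split=> v /=; first by move=> [_ cv] i _; exact: cv.
  by move=> cv; split=> // i j; rewrite ord1; exact: cv.
apply: fin_bigcap_measurable => [|i _]; first exact: finite_finset.
rewrite -[X in measurable X]setTI.
apply: (measurable_rV_coord i measurableT).
by apply: open_measurable; exact: ball_open.
Qed.

(* Only the first factor needs a countable base: an open set is the union,
   over rational balls B, of B x V_B for the largest open V_B with
   B x V_B inside it. *)
Lemma open_prod_measurable (O : set (Rn * U)) :
  open O -> measurable (O : set (Rn * UB)).
Proof.
move=> oO.
pose B (ck : 'rV[rat]_n * nat) : set Rn :=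
  ball (map_mx ratr ck.1 : Rn) (ck.2.+1%:R^-1).
pose V ck : set U := interior [set u | forall x, B ck x -> O (x, u)].
have -> : O = \bigcup_ck (B ck `*` V ck).
  apply/seteqP; split=> [[x u] Oxu|[x u] [ck _ [/= Bx /interior_subset]]];
    last exact.
  move: oO; rewrite openE => /(_ _ Oxu) [[P P'] [/= Px Pu] PO].
  move/nbhs_ballP : Px => [_/posnumP[e] eP].
  (* Half of [e], because [x] and any other point of the rational ball are both within [k.+1%:R^-1]
     of its centre, hence within [e] of each other. *)
  have [k ke] : exists k, k.+1%:R^-1 < e%:num / 2 :> R.
    have := @near_infty_natSinv_lt R (e%:num / 2)%:pos.
    by case=> k _ /(_ k (leqnn _)) ?; exists k.
  have k0 : 0 < k.+1%:R^-1 :> R by rewrite invr_gt0.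
  have /choice[c cx] : forall i : 'I_n, exists q : rat,
      ball (x ord0 i) (k.+1%:R^-1) (ratr q).
    move=> i; pose b := ball (x ord0 i : R^o) (k.+1%:R^-1).
    have b0 : b !=set0 by exists (x ord0 i); exact: ballxx.
    have [r [xr [q _ qr]]] := @dense_rat R b b0 (ball_open _ _).
    by exists q; rewrite qr.
  exists (\row_i c i, k) => //; split=> /=.
    by split=> // a b; rewrite !mxE ord1; apply: ball_sym; exact: cx.
  apply: filterS Pu => u' P'u' x' [_ Bx'].
  apply: (PO (x', u')); split=> //=; apply: eP; split=> // a b.
  have cx' : ball (ratr (c b) : R) k.+1%:R^-1 (x' a b).
    by have /= := Bx' a b; rewrite !mxE.
  rewrite (ord1 a) in cx' *; apply: le_ball (ball_triangle (cx b) cx').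
  by rewrite [leRHS](splitr e%:num) lerD// ltW.
apply: countable_bigcupT_measurable => [|ck]; first exact: countableP.
apply: measurableX; first by apply: measurable_rV_ball; rewrite invr_gt0.
by apply: sub_sigma_algebra; exact: open_interior.
Qed.

(** By continuity on the subspace, the preimage of an open set is the trace on [C] x [U] of an open
    set of the product, and [open_prod_measurable] puts the latter in the product sigma-algebra. The
    value 0 off [C] gives a measurable function on the whole space. *)
Lemma within_continuous_measurable_rV (C : set Rn) (f : Rn * U -> Rn) :
  measurable C -> {within C `*` [set: U], continuous f} ->
  measurable_fun [set: Rn * UB] (fun z => if z.1 \in C then f z else 0).
Proof.
move=> mC cf; apply: measurable_fun_rV => i.
pose D : set (Rn * UB) := C `*` setT.
have mD : measurable D by apply: measurableX.
have mfD : measurable_fun D (fun z => f z ord0 i).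
  apply: (measurability _ (RGenOpens.measurableE R)) => _ [_ [a [b ->]] <-].
  pose V := [set v : Rn | v ord0 i \in `]a, b[].
  have oV : open V.
    apply: (@open_comp _ _ (fun v : Rn => v ord0 i) `]a, b[%classic).
      by move=> v _; exact: coord_continuous.
    exact: interval_open.
  have /continuousP/(_ V oV)/open_subspaceP[W oW WV] := cf.
  rewrite setIC -[X in measurable X]/(f @^-1` V `&` D) -WV.
  by apply: measurableI => //; exact: open_prod_measurable.
rewrite (_ : (fun _ => _) = (fun z => f z ord0 i) \_ D).
  exact/(measurable_restrictT _ mD).
apply/funext => -[x u]; rewrite patchE/=.
have -> : ((x, u) \in D) = (x \in C).
  by apply/idP/idP => /set_mem; [case=> ? _|move=> ?]; apply/mem_set.
by case: ifP => // _; rewrite mxE.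
Qed.

End borel_product.

(** * The filter and its value *)

Section kernels.
Context (R : realType) (n : nat) (dQ : measure_display).
Context (Q : finDiscreteType dQ) (U : pseudoPMetricType R).
Variable H : hybrid_system n Q U.

Local Notation Rn := 'rV[R]_n.
Local Notation S := (Rn * Q)%type.
Local Notation UB := (g_sigma_algebraType (@open U)).
Local Notation K := (safe H).
Local Notation tau := (trans_dens H).
Local Notation h := (obs H).
Local Notation phi := (noise H).
Local Notation Qc := (confusion H).
Local Notation Nq := (#|Q|%:R : R).

Lemma card_modes_gt0 : 0 < Nq.
Proof. by rewrite ltr0n; apply/card_gt0P; exists point. Qed.

(* The density of one observation under the reference measure P^dag. *)
Definition obs_weight (y : S) : R := Nq^-1 * phi y.1.

Lemma obs_weight_gt0 y : 0 < obs_weight y.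
Proof. by rewrite mulr_gt0 ?invr_gt0 ?card_modes_gt0 ?noise_gt0. Qed.

(** One factor of [traj_dens]: the transition from [s] to [s'] times the conditional density of [y]
    under the actual law. *)
Definition step_dens (u : U) (y s' s : S) : R :=
  tau s' s u * (phi (y.1 - h (s'.1, u)) * Qc s'.2 y.2 u).

Definition update_kernel (u : U) (y s' s : S) : R :=
  Nq * Qc s'.2 y.2 u *
  (\1_K s * (phi (y.1 - h (s'.1, u)) / phi y.1) * tau s' s u).

Lemma step_dens_ge0 u y s' s : 0 <= step_dens u y s' s.
Proof.
by rewrite !mulr_ge0 ?trans_dens_ge0// ltW ?noise_gt0 ?confusion_gt0.
Qed.

Lemma update_kernelE u y s' s :
  update_kernel u y s' s = (obs_weight y)^-1 * (\1_K s * step_dens u y s' s).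
Proof.
rewrite /update_kernel /obs_weight /step_dens invfM invrK.
set a := phi (_ - _); set b := phi y.1; set c := Qc _ _ _; set t := tau _ _ _.
by ring.
Qed.

Lemma update_kernel_ge0 u y s' s : 0 <= update_kernel u y s' s.
Proof.
rewrite update_kernelE; apply: mulr_ge0.
  by rewrite invr_ge0 ltW// obs_weight_gt0.
by rewrite mulr_ge0// step_dens_ge0.
Qed.

(** This cancellation is the change of measure for a single step: averaging over observations of the
    reference law leaves the actual density, restricted to safe source states. *)
Lemma update_kernel_weight u y s' s :
  update_kernel u y s' s * obs_weight y = \1_K s * step_dens u y s' s.
Proof.
by rewrite update_kernelE mulrAC mulVf ?mul1r// gt_eqF ?obs_weight_gt0.
Qed.

Lemma measurable_inv_noise : measurable_fun [set: Rn] (fun v => (phi v)^-1).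
Proof.
rewrite (_ : (fun _ => _) = fun v => phi v `^ (-1)).
  exact: measurableT_comp (measurable_powR _) (measurable_noise H).
by apply/funext => v; rewrite powR_inv1// ltW// noise_gt0.
Qed.

Lemma measurable_modes : measurable_fun [set: (Q * Q) * UB]
  (fun z => Qc z.1.1 z.1.2 z.2 : R).
Proof.
rewrite (_ : (fun _ => _) =
  (fun w : (UB * Q) * Q => Qc w.1.2 w.2 w.1.1) \o
    (fun z : (Q * Q) * UB => ((z.2, z.1.1), z.1.2))); last first.
  by apply/funext => -[[]].
apply: measurableT_comp.
  apply: measurable_fun_prod_discrete => m /=.
  by apply: measurable_fun_prod_discrete => q /=; exact: measurable_confusion.
apply: measurable_fun_pair; first apply: measurable_fun_pair => //.
- exact: measurableT_comp measurable_fst measurable_fst.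
- exact: measurableT_comp measurable_snd measurable_fst.
Qed.

Section families.
Context d (T : measurableType d) (u : T -> UB) (y s' s : T -> S).
Hypothesis mu : measurable_fun [set: T] u.
Hypothesis my : measurable_fun [set: T] y.
Hypothesis ms' : measurable_fun [set: T] s'.
Hypothesis ms : measurable_fun [set: T] s.

Lemma measurable_obs_weight : measurable_fun [set: T] (fun t => obs_weight (y t)).
Proof.
apply: measurable_funM => //.
apply: measurableT_comp (measurable_noise H) _.
exact: measurableT_comp measurable_fst my.
Qed.

Lemma measurable_trans : measurable_fun [set: T] (fun t => tau (s' t) (s t) (u t)).
Proof.
rewrite (_ : (fun _ => _) = (fun z : S * (S * UB) => tau z.1 z.2.1 z.2.2) \o
  (fun t => (s' t, (s t, u t)))) //.
apply: measurableT_comp (measurable_trans_dens H) _.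
by apply: measurable_fun_pair => //; apply: measurable_fun_pair.
Qed.

(* [obs] is only continuous over [cspace], off which [tau] vanishes. *)
Lemma measurable_step_dens :
  measurable_fun [set: T] (fun t => step_dens (u t) (y t) (s' t) (s t)).
Proof.
pose hC (z : Rn * UB) := if z.1 \in cspace H then h z else 0.
have mh : measurable_fun setT hC.
  apply: (@within_continuous_measurable_rV _ _ _ (cspace H) h).
    exact: measurable_cspace.
  exact: obs_continuous.
rewrite (_ : (fun _ => _) = (fun t => tau (s' t) (s t) (u t) *
    (phi ((y t).1 - hC ((s' t).1, u t)) * Qc (s' t).2 (y t).2 (u t)))).
  apply: measurable_funM; first exact: measurable_trans.
  apply: measurable_funM.
    apply: measurableT_comp (measurable_noise H) _.
    apply: measurable_rVB; first exact: measurableT_comp measurable_fst my.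
    apply: measurableT_comp mh _; apply: measurable_fun_pair => //.
    exact: measurableT_comp measurable_fst ms'.
  rewrite (_ : (fun _ => _) = (fun z => Qc z.1.1 z.1.2 z.2 : R) \o
    (fun t => (((s' t).2, (y t).2), u t)))//.
  apply: measurableT_comp measurable_modes _.
  apply: measurable_fun_pair => //; apply: measurable_fun_pair.
  - exact: measurableT_comp measurable_snd ms'.
  - exact: measurableT_comp measurable_snd my.
apply/funext => t; rewrite /step_dens /hC /=; case: ifPn => // /negP s'C.
by rewrite trans_dens_out ?mul0r// => /mem_set.
Qed.

Lemma measurable_update_kernel :
  measurable_fun [set: T] (fun t => update_kernel (u t) (y t) (s' t) (s t)).
Proof.
under eq_fun do rewrite update_kernelE /obs_weight invfM invrK.
apply: measurable_funM.
  apply: measurable_funM => //.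
  apply: measurableT_comp measurable_inv_noise _.
  exact: measurableT_comp measurable_fst my.
apply: measurable_funM; last exact: measurable_step_dens.
rewrite (_ : (fun _ => _) = (\1_K : S -> R) \o s)//.
apply: measurableT_comp _ ms.
by apply: measurable_indic; exact: measurable_safe.
Qed.

End families.

End kernels.

Section information_state_control.
Local Open Scope ereal_scope.
Context (R : realType) (n : nat) (dQ : measure_display).
Context (Q : finDiscreteType dQ) (U : pseudoPMetricType R).
Variable H : hybrid_system n Q U.

Local Notation Rn := 'rV[R]_n.
Local Notation S := (Rn * Q)%type.
Local Notation UB := (g_sigma_algebraType (@open U)).
Local Notation leb := (lebesgue_rV R n).
Local Notation nu := (sprod leb (@counting Q R)).
Local Notation K := (safe H).
Local Notation tau := (trans_dens H).
Local Notation rho := (init_dens H).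
Local Notation Nq := (#|Q|%:R : R).
Local Notation weight := (obs_weight H).
Local Notation kern := (update_kernel H).
Local Notation step := (step_dens H).
Local Notation isfun := (isfun R n Q).
Local Notation info_states := (@info_states R n dQ Q).

(** Joint measurability in parameter and state is what Tonelli asks for, and it is preserved by
    updates whose control and observation depend on the parameter. *)
Definition measurable_family d (T : measurableType d) (sigma : T -> isfun) :=
  measurable_fun [set: T * S] (fun z => sigma z.1 z.2) /\
  forall t s, 0 <= sigma t s.

Lemma measurable_family_comp d d' (T : measurableType d)
    (T' : measurableType d') (sigma : T -> isfun) (g : T' -> T) :
  measurable_family sigma -> measurable_fun [set: T'] g ->
  measurable_family (sigma \o g).
Proof.
move=> [ms s0] mg; split=> [|t s]; last exact: s0.
rewrite (_ : (fun _ => _) = (fun z : T * S => sigma z.1 z.2) \o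
  (fun z : T' * S => (g z.1, z.2)))//.
apply: measurableT_comp ms _; apply: measurable_fun_pair => //.
exact: measurableT_comp mg measurable_fst.
Qed.

Lemma measurable_family_cst d (T : measurableType d) (sigma : isfun) :
  measurable_fun [set: S] sigma -> (forall s, 0 <= sigma s) ->
  measurable_family (fun _ : T => sigma).
Proof.
by move=> ms s0; split=> //; exact: measurableT_comp ms measurable_snd.
Qed.

Lemma measurable_family_at d (T : measurableType d) (sigma : T -> isfun) t :
  measurable_family sigma -> measurable_fun [set: S] (sigma t).
Proof.
move=> [ms _].
rewrite (_ : sigma t = (fun z : T * S => sigma z.1 z.2) \o pair t)//.
by apply: measurableT_comp ms _; exact: measurable_fun_pair.
Qed.

Lemma measurable_family_integral d (T : measurableType d)
    (sigma : T -> isfun) :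
  measurable_family sigma ->
  measurable_fun [set: T] (fun t => \int[nu]_s sigma t s).
Proof. by move=> [ms s0]; exact: measurable_int_param. Qed.

(** These integrals are the evaluations generating the sigma-algebra [isfun_gen], so this makes
    [sigma] measurable as a map into information states. *)
Lemma measurable_family_section d (T : measurableType d)
    (sigma : T -> isfun) (q : Q) (A : set Rn) :
  measurable_family sigma -> measurable A ->
  measurable_fun [set: T] (fun t => \int[leb]_(x in A) sigma t (x, q)).
Proof.
move=> [ms s0] mA; under eq_fun do rewrite integral_mkcond.
apply: measurable_int_param => [|t x]; last by rewrite patchE; case: ifP.
under eq_fun => z.
  rewrite epatch_indic; over.
apply: emeasurable_funM.
  rewrite (_ : (fun _ => _) = (fun z : T * S => sigma z.1 z.2) \o
    (fun z : T * Rn => (z.1, (z.2, q))))//.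
  apply: measurableT_comp ms _; apply: measurable_fun_pair => //.
  by apply: measurable_fun_pair.
apply/measurable_EFinP.
rewrite (_ : (fun _ => _) = (\1_A : Rn -> R) \o snd)//.
by apply: measurableT_comp => //; exact: measurable_indic.
Qed.

Lemma is_update_ge0 u y (sigma : isfun) s :
  (forall s, 0 <= sigma s) -> 0 <= is_update H u y sigma s.
Proof.
move=> s0; apply: sume_ge0 => q _; apply: mule_ge0.
  by rewrite lee_fin mulr_ge0// ltW// confusion_gt0.
apply: integral_ge0 => x _; rewrite mule_ge0// lee_fin.
by rewrite !mulr_ge0 ?trans_dens_ge0 ?invr_ge0 ?(ltW (noise_gt0 _ _)).
Qed.

Lemma is_updateE u y (sigma : isfun) s' :
  measurable_fun [set: S] sigma -> (forall s, 0 <= sigma s) ->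
  is_update H u y sigma s' = \int[nu]_s ((kern u y s' s)%:E * sigma s).
Proof.
move=> ms s0.
have mk : measurable_fun [set: S] (fun s => (kern u y s' s)%:E * sigma s).
  apply: emeasurable_funM => //; apply/measurable_EFinP.
  exact: (@measurable_update_kernel _ _ _ _ _ H _ _ (cst u)).
rewrite integral_sprod_counting//; last first.
  by move=> s; rewrite mule_ge0// lee_fin update_kernel_ge0.
have c0 : (0 < Nq * confusion H s'.2 y.2 u)%R.
  by rewrite mulr_gt0 ?card_modes_gt0 ?confusion_gt0.
apply: eq_bigr => q _; rewrite -ge0_integralZl//.
- by apply: eq_integral => x _; rewrite muleA -EFinM.
(* The integrand without its constant factor is recovered from the measurable [kern] by dividing by
   that factor, which is positive. *)
- rewrite (_ : (fun _ => _) = (fun x => ((Nq * confusion H s'.2 y.2 u)^-1)%R%:E *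
    ((kern u y s' (x, q))%:E * sigma (x, q)))); last first.
    apply/funext => x; rewrite muleA -EFinM; congr (_%:E * _).
    by rewrite /update_kernel mulKf// gt_eqF.
  apply: measurable_funeM; apply: (measurableT_comp mk).
  exact: measurable_fun_pair.
- move=> x _; rewrite mule_ge0// lee_fin.
  by rewrite !mulr_ge0 ?trans_dens_ge0 ?invr_ge0 ?(ltW (noise_gt0 _ _)).
- by rewrite lee_fin ltW.
Qed.

Lemma measurable_family_update d (T : measurableType d) (u : T -> UB)
    (y : T -> S) (sigma : T -> isfun) :
  measurable_fun [set: T] u -> measurable_fun [set: T] y ->
  measurable_family sigma ->
  measurable_family (fun t => is_update H (u t) (y t) (sigma t)).
Proof.
move=> mu my fs; have [ms s0] := fs; split=> [|t s]; last first.
  exact: is_update_ge0.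
under eq_fun => z.
  rewrite is_updateE//; last exact: measurable_family_at.
  over.
apply: measurable_int_param => [|z s]; last first.
  by rewrite mule_ge0// lee_fin update_kernel_ge0.
apply: emeasurable_funM.
  apply/measurable_EFinP.
  apply: (@measurable_update_kernel _ _ _ _ _ H _ _ (fun z => u z.1.1)
    (fun z => y z.1.1) (fun z => z.1.2) snd) => //.
  - exact: measurableT_comp mu (measurableT_comp measurable_fst measurable_fst).
  - exact: measurableT_comp my (measurableT_comp measurable_fst measurable_fst).
  - exact: measurableT_comp measurable_snd measurable_fst.
rewrite (_ : (fun _ => _) = (fun z : T * S => sigma z.1 z.2) \o
  (fun z : (T * S) * S => (z.1.1, z.2)))//.
apply: measurableT_comp ms _; apply: measurable_fun_pair => //.
exact: measurableT_comp measurable_fst measurable_fst.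
Qed.

(** * Mass of an information state under an update *)

Lemma trans_dens_int u s : cspace H s.1 -> \int[nu]_s' (tau s' s u)%:E = 1.
Proof.
case: s => x q /= Cx.
rewrite integral_sprod_counting; last 2 first.
- apply/measurable_EFinP.
  exact: (@measurable_trans _ _ _ _ _ H _ _ (cst u) id (cst (x, q))).
- by move=> s'; rewrite lee_fin trans_dens_ge0.
(* Over all of R^n the kernel [Tx] has mass 1, which leaves the mass of [Tq]. The factorization is
   assumed only from sources in [cspace]. *)
transitivity (\sum_(q' : Q) Tq H ((x, q), u) [set q']).
  apply: eq_bigr => q' _; rewrite trans_densE//.
  by rewrite (@prob_kernel _ _ _ _ _ (Tx H)) mul1e.
by rewrite -measure_discrete prob_kernel.
Qed.

Lemma step_dens_obs_int u s' s :
  \int[nu]_y (step u y s' s)%:E = (tau s' s u)%:E.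
Proof.
have mstep : measurable_fun [set: S] (fun y => (step u y s' s)%:E).
  apply/measurable_EFinP.
  exact: (@measurable_step_dens _ _ _ _ _ H _ _ (cst u) id (cst s') (cst s)).
have mphi c : measurable_fun [set: Rn] (fun v => (noise H (v - c))%:E).
  apply/measurable_EFinP; apply: measurableT_comp (measurable_noise H) _.
  exact: measurable_rVB.
rewrite integral_sprod_counting//; last first.
  by move=> y; rewrite lee_fin step_dens_ge0.
transitivity (\sum_(m : Q) (tau s' s u * confusion H s'.2 m u)%:E).
  apply: eq_bigr => m _.
  under eq_integral do rewrite /step_dens/= mulrCA mulrC EFinM.
  rewrite ge0_integralZl//; last 2 first.
  - by move=> v _; rewrite lee_fin ltW// noise_gt0.
  - by rewrite lee_fin mulr_ge0 ?trans_dens_ge0// ltW// confusion_gt0.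
  have -> : \int[leb]_v (noise H (v - obs H (s'.1, u)))%:E = 1.
    rewrite -(noise_int H).
    apply: (@ge0_integral_lebesgue_rVB _ _ _ (fun v => (noise H v)%:E)).
      by apply/measurable_EFinP; exact: measurable_noise.
    by move=> v; rewrite lee_fin ltW// noise_gt0.
  by rewrite mule1.
by rewrite sumEFin -mulr_sumr confusion_sum mulr1.
Qed.


Lemma measurable_kern_family u y s' (sigma : isfun) :
  measurable_fun [set: S] sigma ->
  measurable_fun [set: S] (fun s => (kern u y s' s)%:E * sigma s).
Proof.
move=> ms; apply: emeasurable_funM => //; apply/measurable_EFinP.
exact: (@measurable_update_kernel _ _ _ _ _ H _ _ (cst u)).
Qed.

Lemma is_update_weight u y (sigma : isfun) s' :
  measurable_fun [set: S] sigma -> (forall s, 0 <= sigma s) ->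
  is_update H u y sigma s' * (weight y)%:E =
  \int[nu]_s ((\1_K s * step u y s' s)%:E * sigma s).
Proof.
move=> ms s0; rewrite is_updateE// -ge0_integralZr//; last 3 first.
- exact: measurable_kern_family.
- by move=> s _; rewrite mule_ge0// lee_fin update_kernel_ge0.
- by rewrite lee_fin ltW// obs_weight_gt0.
apply: eq_integral => s _.
by rewrite muleAC -EFinM update_kernel_weight.
Qed.

Lemma measurable_family_update1 u (sigma : isfun) :
  measurable_fun [set: S] sigma -> (forall s, 0 <= sigma s) ->
  measurable_family (fun y => is_update H u y sigma).
Proof.
move=> ms s0; apply: (@measurable_family_update _ _ (cst u) id) => //.
exact: measurable_family_cst.
Qed.

Lemma measurable_weight d (T : measurableType d) (y : T -> S) :
  measurable_fun [set: T] y ->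
  measurable_fun [set: T] (fun t => (weight (y t))%:E).
Proof. by move=> my; apply/measurable_EFinP; exact: measurable_obs_weight. Qed.

(** The left-hand side is in fact the mass of [sigma] on [K]; what is lost is the mass on unsafe
    states. The indicator also removes sources outside [cspace], from which [tau] need not integrate
    to 1. *)
Lemma update_mass u (sigma : isfun) :
  measurable_fun [set: S] sigma -> (forall s, 0 <= sigma s) ->
  \int[nu]_y ((\int[nu]_s' is_update H u y sigma s') * (weight y)%:E) <=
  \int[nu]_s sigma s.
Proof.
move=> ms s0.
pose f y s' s := (\1_K s * step u y s' s)%:E * sigma s.
have f0 y s' s : 0 <= f y s' s.
  by rewrite mule_ge0// lee_fin mulr_ge0// step_dens_ge0.
have mf d (T : measurableType d) (y s' s : T -> S) :
    measurable_fun setT y -> measurable_fun setT s' -> measurable_fun setT s ->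
    measurable_fun setT (fun t => f (y t) (s' t) (s t)).
  move=> my ms' msT; apply: emeasurable_funM; last first.
    exact: measurableT_comp ms msT.
  apply/measurable_EFinP; apply: measurable_funM; last first.
    exact: (@measurable_step_dens _ _ _ _ _ H _ _ (cst u)).
  rewrite (_ : (fun _ => _) = (\1_K : S -> R) \o s)//.
  apply: measurableT_comp _ msT.
  by apply: measurable_indic; exact: measurable_safe.
rewrite (_ : \int[nu]_y _ = \int[nu]_y \int[nu]_s' \int[nu]_s f y s' s); last first.
  apply: eq_integral => y _; rewrite -ge0_integralZr//; last 3 first.
  - exact: measurable_family_at (measurable_family_update1 u ms s0).
  - by move=> s' _; exact: is_update_ge0.
  - by rewrite lee_fin ltW// obs_weight_gt0.
  by apply: eq_integral => s' _; rewrite is_update_weight.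
have mf2 d (T : measurableType d) (y s' : T -> S) :
    measurable_fun setT y -> measurable_fun setT s' ->
    measurable_fun setT (fun t => \int[nu]_s f (y t) (s' t) s).
  move=> my ms'; apply: measurable_int_param => //; apply: mf => //.
  - exact: measurableT_comp my measurable_fst.
  - exact: measurableT_comp ms' measurable_fst.
pose g s' s := (\1_K s * tau s' s u)%:E * sigma s.
have mg : measurable_fun [set: S * S] (fun z => g z.1 z.2).
  apply: emeasurable_funM; last exact: measurableT_comp ms measurable_snd.
  apply/measurable_EFinP; apply: measurable_funM; last first.
    exact: (@measurable_trans _ _ _ _ _ H _ _ (cst u)).
  rewrite (_ : (fun _ => _) = (\1_K : S -> R) \o snd)//.
  apply: measurableT_comp => //.
  by apply: measurable_indic; exact: measurable_safe.
have g0 s' s : 0 <= g s' s.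
  by rewrite mule_ge0// lee_fin mulr_ge0// trans_dens_ge0.
have fg s' s : \int[nu]_y f y s' s = g s' s.
  have mstep : measurable_fun [set: S] (fun y => (step u y s' s)%:E).
    apply/measurable_EFinP.
    exact: (@measurable_step_dens _ _ _ _ _ H _ _ (cst u) id (cst s') (cst s)).
  rewrite (_ : (fun _ => _) =
      fun y => (\1_K s)%:E * sigma s * (step u y s' s)%:E); last first.
    by apply/funext => y; rewrite /f EFinM muleAC.
  rewrite ge0_integralZl//.
  - by rewrite step_dens_obs_int /g EFinM muleAC.
  - by move=> y _; rewrite lee_fin step_dens_ge0.
  - by rewrite mule_ge0.
(* Two exchanges bring [y] innermost, past [s'] and then past [s], where it integrates out and
   leaves [g]; a third brings [s'] innermost for the transition density. *)
rewrite integral_swap; last 2 first.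
- exact: mf2.
- by move=> y s'; exact: integral_ge0.
under eq_integral => s' _.
  rewrite integral_swap//; last exact: mf.
  under eq_integral do rewrite fg.
  over.
rewrite integral_swap//.
apply: ge0_le_integral_nonmeas => s; first exact: integral_ge0.
rewrite /g; case: (pselect (K s)) => [Ks|nKs]; last first.
  by rewrite integral0_eq// => s' _; rewrite indicE memNset// mul0r mul0e.
rewrite ge0_integralZr//.
- under eq_integral do rewrite indicE mem_set// mul1r.
  by rewrite trans_dens_int ?mul1e//; exact: safe_sub.
- apply/measurable_EFinP; apply: measurable_funM => //.
  exact: (@measurable_trans _ _ _ _ _ H _ _ (cst u) id (cst s)).
- by move=> s' _; rewrite lee_fin mulr_ge0// trans_dens_ge0.
Qed.

(** The weighted mass has a finite integral over the observations, so it is almost everywhere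
    finite, and the weight is positive. The statement is per mode because [ref_step] integrates over
    each mode separately. *)
Lemma update_info_state u (sigma : isfun) : info_states sigma ->
  forall m : Q, {ae leb, forall y, info_states (is_update H u (y, m) sigma)}.
Proof.
move=> [s0 /integrableP[ms]].
under eq_integral do rewrite gee0_abs//.
move=> sfin m.
pose mass y := (\int[nu]_s' is_update H u y sigma s').
have fu := measurable_family_update1 u ms s0.
have mmass : measurable_fun [set: S] (fun y => mass y * (weight y)%:E).
  apply: emeasurable_funM; first exact: measurable_family_integral.
  exact: measurable_weight.
have mass0 y : 0 <= mass y by apply: integral_ge0 => s' _; exact: is_update_ge0.
have w0 y : 0 <= (weight y)%:E by rewrite lee_fin ltW// obs_weight_gt0.
have mm : measurable_fun [set: Rn] (fun x => mass (x, m) * (weight (x, m))%:E).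
  rewrite (_ : (fun _ => _) = (fun y => mass y * (weight y)%:E) \o pair^~ m)//.
  by apply: measurableT_comp mmass _; exact: measurable_fun_pair.
have : leb.-integrable [set: Rn] (fun x => mass (x, m) * (weight (x, m))%:E).
  apply/integrableP; split=> //.
  under eq_integral do rewrite gee0_abs ?mule_ge0//.
  have : \int[nu]_y (mass y * (weight y)%:E) <= \int[nu]_s sigma s.
    exact: update_mass.
  move=> /le_lt_trans/(_ sfin); apply: le_lt_trans.
  rewrite integral_sprod_counting// => [|y]; last by rewrite mule_ge0.
  rewrite [leRHS](bigD1 m)//= leeDl//; apply: sume_ge0 => q _.
  by apply: integral_ge0 => x _; rewrite mule_ge0.
move=> /(integrable_ae measurableT); apply: filterS => x /(_ I) fin.
split=> [s|]; first exact: is_update_ge0.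
apply/integrableP; split; first exact: (measurable_family_at (x, m) fu).
under eq_integral do rewrite gee0_abs ?is_update_ge0//.
rewrite -/(mass _) ltey; apply/eqP => massoo; move: fin.
by rewrite massoo gt0_mulye// lte_fin obs_weight_gt0.
Qed.


(** * The filter along the observations, under a policy *)

Lemma eta_tsnoc k (ys : k.-tuple S) y (us : k.-tuple UB) (u : UB) :
  eta H k.+1 (tsnoc (ys, y), tsnoc (us, u)) =
  is_update H u y (eta H k (ys, us)).
Proof.
by rewrite /eta /= zip_rcons ?size_tuple// foldl_rcons.
Qed.

Lemma controls_tsnoc (mu : policy n Q U) k (ys : k.-tuple S) y :
  controls mu (tsnoc (ys, y)) =
  tsnoc ((controls mu ys, mu k (ys, controls mu ys)) : k.-tuple UB * UB).
Proof. by rewrite /= tinit_tsnoc. Qed.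

Lemma measurable_eta k :
  measurable_family (eta H k : k.-tuple S * k.-tuple UB -> isfun).
Proof.
elim: k => [|k IH].
  rewrite (_ : eta H 0 = fun=> fun s => (rho s)%:E); last first.
    by apply/funext => -[ys us]; rewrite /eta (tuple0 ys) (tuple0 us).
  apply: measurable_family_cst => [|s]; last by rewrite lee_fin init_dens_ge0.
  by apply/measurable_EFinP; exact: measurable_init_dens.
rewrite (_ : eta H k.+1 = fun i : k.+1.-tuple S * k.+1.-tuple UB =>
    is_update H (tunsnoc i.2).2 (tunsnoc i.1).2
      (eta H k ((tunsnoc i.1).1, (tunsnoc i.2).1))); last first.
  apply/funext => -[ys us].
  (* Controls are retyped from [U] to its Borel copy [UB], which has the same elements, because
     [tsnoc] and [tunsnoc] take a measurable type. *)
  rewrite -[ys in LHS]tunsnocK -[us in LHS](@tunsnocK _ UB).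
  change (eta H k.+1 (tsnoc (tunsnoc ys), tsnoc (@tunsnoc _ UB _ us)) =
    is_update H (@tunsnoc _ UB _ us).2 (tunsnoc ys).2
      (eta H k ((tunsnoc ys).1, (@tunsnoc _ UB _ us).1))).
  case: (tunsnoc ys) => ys' y.
  by case: (@tunsnoc _ UB _ us) => us' u; rewrite eta_tsnoc.
have m1 : measurable_fun [set: k.+1.-tuple S * k.+1.-tuple UB]
    (fun i => tunsnoc i.1).
  exact: measurableT_comp (@measurable_tunsnoc _ _ _) measurable_fst.
have m2 : measurable_fun [set: k.+1.-tuple S * k.+1.-tuple UB]
    (fun i => tunsnoc i.2).
  exact: measurableT_comp (@measurable_tunsnoc _ UB _) measurable_snd.
apply: measurable_family_update.
- exact: measurableT_comp measurable_snd m2.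
- exact: measurableT_comp measurable_snd m1.
- apply: (measurable_family_comp (g := fun i : k.+1.-tuple S * k.+1.-tuple UB =>
    ((tunsnoc i.1).1, (tunsnoc i.2).1)) IH).
  apply: measurable_fun_pair.
  + exact: measurableT_comp measurable_fst m1.
  + exact: measurableT_comp measurable_fst m2.
Qed.

Lemma measurable_eta_at k (i : k.-tuple S * k.-tuple UB) :
  measurable_fun [set: S] (eta H k i).
Proof. exact: (measurable_family_at i (measurable_eta k)). Qed.

Lemma eta_ge0 k (i : k.-tuple S * k.-tuple UB) s : 0 <= eta H k i s.
Proof. by have [_] := measurable_eta k; exact. Qed.

Section closed_loop_states.
Variables (N : nat) (mu : policy n Q U).
Hypothesis mmu : admissible N mu.

(** Stated for the pair and not for the controls alone, since the pair is the argument of [mu k] at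
    the next step. *)
Lemma measurable_info_controls k : (k <= N)%N ->
  measurable_fun [set: k.-tuple S]
    (fun ys => (ys, controls mu ys) : k.-tuple S * k.-tuple UB).
Proof.
elim: k => [|k IH] kN; apply: measurable_fun_pair => //.
  exact: measurable_cst.
have mi : measurable_fun [set: k.+1.-tuple S] (@tinit S k).
  exact: measurableT_comp measurable_fst (@measurable_tunsnoc _ _ _).
have mci : measurable_fun [set: k.+1.-tuple S]
    (fun ys => (tinit ys, controls mu (tinit ys)) : k.-tuple S * k.-tuple UB).
  exact: measurableT_comp (IH (ltnW kN)) mi.
rewrite (_ : controls mu (k := k.+1) = @tsnoc _ UB k \o
  (fun ys => (controls mu (tinit ys),
    @mu k (tinit ys, controls mu (tinit ys)))))//.
apply: measurableT_comp; first exact: measurable_tsnoc.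
apply: measurable_fun_pair; first exact: measurableT_comp measurable_snd mci.
exact: measurableT_comp (mmu kN) mci.
Qed.

Lemma measurable_control k : (k < N)%N ->
  measurable_fun [set: k.-tuple S] (fun ys => @mu k (ys, controls mu ys) : UB).
Proof.
move=> kN; exact: measurableT_comp (mmu kN) (measurable_info_controls (ltnW kN)).
Qed.

Lemma measurable_closed_eta k : (k <= N)%N ->
  measurable_family (fun ys : k.-tuple S => eta H k (ys, controls mu ys)).
Proof.
move=> kN.
exact: (measurable_family_comp (measurable_eta k) (measurable_info_controls kN)).
Qed.

End closed_loop_states.

(** The density of the first [k] observations under the reference law. As it is positive, null sets
    for that law and for [mpow nu k] are the same. *)
Definition obs_weights k (ys : k.-tuple S) : R := (\prod_(l < k) weight (tnth ys l))%R.

Lemma obs_weights_gt0 k (ys : k.-tuple S) : (0 < obs_weights ys)%R.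
Proof. by apply: prodr_gt0 => l _; exact: obs_weight_gt0. Qed.

Lemma obs_weights_tsnoc k (ys : k.-tuple S) y :
  obs_weights (tsnoc (ys, y)) = (obs_weights ys * weight y)%R.
Proof.
rewrite /obs_weights big_ord_recr/= tsnoc_max; congr (_ * _)%R.
by apply: eq_bigr => l _; rewrite tsnoc_widen.
Qed.

Lemma measurable_obs_weights k :
  measurable_fun [set: k.-tuple S] (fun ys => (obs_weights ys)%:E).
Proof.
apply/measurable_EFinP; apply: measurable_prod => l _.
by apply: measurable_obs_weight; exact: measurable_tnth.
Qed.

(* The expectation of [f] under P^dag, where the observations are i.i.d. *)
Definition obs_int k (f : k.-tuple S -> \bar R) : \bar R :=
  \int[mpow nu k]_ys (f ys * (obs_weights ys)%:E).

Lemma obs_int0 (f : 0.-tuple S -> \bar R) : measurable_fun setT f ->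
  obs_int f = f [tuple].
Proof.
move=> mf; rewrite /obs_int integral_mpow0; last first.
  by apply: emeasurable_funM => //; exact: measurable_obs_weights.
by rewrite /obs_weights big_ord0 mule1.
Qed.

(** The tower property: under the reference law the last observation is independent of the earlier
    ones, so its weight factors out. *)
Lemma obs_intS k (f : k.+1.-tuple S -> \bar R) : measurable_fun setT f ->
  (forall ys, 0 <= f ys) ->
  obs_int f = obs_int (fun ys =>
    \int[nu]_y (f (tsnoc (ys, y)) * (weight y)%:E)).
Proof.
move=> mf f0; rewrite /obs_int integral_mpowS//; last 2 first.
- by apply: emeasurable_funM => //; exact: measurable_obs_weights.
- by move=> ys; rewrite mule_ge0// lee_fin ltW// obs_weights_gt0.
apply: eq_integral => ys _; rewrite -ge0_integralZr//.
- by apply: eq_integral => y _; rewrite obs_weights_tsnoc EFinM muleAC muleA.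
- apply: emeasurable_funM; last exact: measurable_weight.
  rewrite (_ : (fun _ => _) = f \o (@tsnoc _ _ _) \o pair ys)//.
  apply: measurableT_comp; last exact: measurable_fun_pair.
  exact: measurableT_comp mf (@measurable_tsnoc _ _ _).
- by move=> y _; rewrite mule_ge0// lee_fin ltW// obs_weight_gt0.
- by rewrite lee_fin ltW// obs_weights_gt0.
Qed.

Lemma obs_int_le_ae k (f g : k.-tuple S -> \bar R) :
  measurable_fun setT f -> measurable_fun setT g ->
  (forall ys, 0 <= f ys) -> (forall ys, 0 <= g ys) ->
  {ae mpow nu k, forall ys, f ys <= g ys} -> obs_int f <= obs_int g.
Proof.
move=> mf mg f0 g0 fg.
have w0 ys : 0 <= (obs_weights (k := k) ys)%:E.
  by rewrite lee_fin ltW// obs_weights_gt0.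
apply: ae_ge0_le_integral => //.
- by move=> ys _; rewrite mule_ge0.
- by apply: emeasurable_funM => //; exact: measurable_obs_weights.
- by move=> ys _; rewrite mule_ge0.
- by apply: emeasurable_funM => //; exact: measurable_obs_weights.
- by apply: filterS fg => ys ? _; rewrite lee_wpmul2r.
Qed.

(** The mass is 1 for [rho], and [update_mass] applies at each observation record, which fixes both
    the information state and the next control. *)
Lemma closed_eta_mass N (mu : policy n Q U) k :
  admissible N mu -> (k <= N)%N ->
  obs_int (fun ys : k.-tuple S => \int[nu]_s eta H k (ys, controls mu ys) s) <= 1.
Proof.
move=> mmu; elim: k => [|k IH] kN.
  rewrite obs_int0; last first.
    exact: measurable_family_integral (measurable_closed_eta mmu kN).
  rewrite -(init_dens_int H) integral_sprod_counting//.
  - by apply/measurable_EFinP; exact: measurable_init_dens.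
  - by move=> s; rewrite lee_fin init_dens_ge0.
have mass0 j (ys : j.-tuple S) :
    0 <= \int[nu]_s eta H j (ys, controls mu ys) s.
  by apply: integral_ge0 => s _; exact: eta_ge0.
have mm j : (j <= N)%N -> measurable_fun [set: j.-tuple S]
    (fun ys => \int[nu]_s eta H j (ys, controls mu ys) s).
  move=> jN; exact: measurable_family_integral (measurable_closed_eta mmu jN).
rewrite obs_intS//; last exact: mm.
apply: le_trans (IH (ltnW kN)).
apply: ge0_le_integral_nonmeas => ys.
  rewrite mule_ge0//; last by rewrite lee_fin ltW// obs_weights_gt0.
  by apply: integral_ge0 => y _; rewrite mule_ge0// lee_fin ltW// obs_weight_gt0.
rewrite lee_wpmul2r//; first by rewrite lee_fin ltW// obs_weights_gt0.
under eq_integral do rewrite controls_tsnoc eta_tsnoc.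
apply: update_mass; first exact: measurable_eta_at.
by move=> s; exact: eta_ge0.
Qed.

Lemma closed_eta_info_state N (mu : policy n Q U) k :
  admissible N mu -> (k <= N)%N ->
  {ae mpow nu k, forall ys, info_states (eta H k (ys, controls mu ys))}.
Proof.
move=> mmu kN.
pose mass (ys : k.-tuple S) := \int[nu]_s eta H k (ys, controls mu ys) s.
have mass0 ys : 0 <= mass ys by apply: integral_ge0 => s _; exact: eta_ge0.
have w0 (ys : k.-tuple S) : 0 <= (obs_weights ys)%:E.
  by rewrite lee_fin ltW// obs_weights_gt0.
have : (mpow nu k).-integrable setT (fun ys => mass ys * (obs_weights ys)%:E).
  apply/integrableP; split.
    apply: emeasurable_funM; last exact: measurable_obs_weights.
    exact: measurable_family_integral (measurable_closed_eta mmu kN).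
  under eq_integral do rewrite gee0_abs ?mule_ge0//.
  exact: le_lt_trans (closed_eta_mass mmu kN) (ltry 1).
move=> /(integrable_ae measurableT); apply: filterS => ys /(_ I) fin.
split=> [s|]; first exact: eta_ge0.
apply/integrableP; split; first exact: measurable_eta_at.
under eq_integral do rewrite gee0_abs ?eta_ge0//.
rewrite -/(mass _) ltey; apply/eqP => massoo; move: fin.
by rewrite massoo gt0_mulye// lte_fin obs_weights_gt0.
Qed.


(** * Value functions and dynamic programming *)

Lemma pairingE (sigma : isfun) :
  measurable_fun [set: S] sigma -> (forall s, 0 <= sigma s) ->
  pairing sigma K = \int[nu]_s (sigma s * (\1_K s)%:E).
Proof.
move=> ms s0; rewrite integral_sprod_counting//.
- apply: emeasurable_funM => //; apply/measurable_EFinP.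
  by apply: measurable_indic; exact: measurable_safe.
- by move=> s; rewrite mule_ge0// lee_fin.
Qed.

Lemma pairing_ge0 (sigma : isfun) :
  (forall s, 0 <= sigma s) -> 0 <= pairing sigma K.
Proof.
move=> s0; apply: sume_ge0 => q _; apply: integral_ge0 => x _.
by rewrite mule_ge0// lee_fin.
Qed.

Lemma measurable_pairing d (T : measurableType d) (sigma : T -> isfun) :
  measurable_family sigma ->
  measurable_fun [set: T] (fun t => pairing (sigma t) K).
Proof.
move=> fs; have [ms s0] := fs.
under eq_fun do rewrite (pairingE (measurable_family_at _ fs) (s0 _)).
apply: measurable_int_param => [|t s]; last by rewrite mule_ge0// lee_fin.
apply: emeasurable_funM => //; apply/measurable_EFinP.
rewrite (_ : (fun _ => _) = (\1_K : S -> R) \o snd)//.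
apply: measurableT_comp => //.
by apply: measurable_indic; exact: measurable_safe.
Qed.

Lemma ref_step_ge0 (V : isfun -> \bar R) u (sigma : isfun) :
  (forall sigma : isfun, (forall s, 0 <= sigma s) -> 0 <= V sigma) ->
  (forall s, 0 <= sigma s) -> 0 <= ref_step H V u sigma.
Proof.
move=> V0 s0; apply: sume_ge0 => m _; apply: integral_ge0 => y _.
rewrite mule_ge0//; last by rewrite lee_fin ltW// (obs_weight_gt0 _ (y, m)).
by apply: V0 => s; exact: is_update_ge0.
Qed.

Lemma value_to_go_ge0 j (sigma : isfun) :
  (forall s, 0 <= sigma s) -> 0 <= value_to_go H j sigma.
Proof.
elim: j sigma => [|j IH] sigma s0 /=; first exact: pairing_ge0.
(* The supremum is over a nonempty set, [U] being pointed; otherwise it would be minus infinity. *)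
apply: le_trans (ereal_sup_ubound _); last by exists point.
exact: ref_step_ge0.
Qed.

(* Only the values on the information states matter: almost every update of an
   information state is one. *)
Lemma eq_ref_step (V V' : isfun -> \bar R) u (sigma : isfun) :
  (forall sigma : isfun, (forall s, 0 <= sigma s) -> 0 <= V sigma) ->
  (forall sigma : isfun, (forall s, 0 <= sigma s) -> 0 <= V' sigma) ->
  measurable_fun [set: S] (fun y => V' (is_update H u y sigma)) ->
  (forall sigma, info_states sigma -> V sigma = V' sigma) ->
  info_states sigma ->
  ref_step H V u sigma = ref_step H V' u sigma.
Proof.
move=> V0 V'0 mV' VV' Ss; have [s0 _] := Ss.
apply: eq_bigr => m _; apply: ge0_integral_ae_nonmeas.
- move=> y; rewrite mule_ge0//.
    by apply: V0 => s; exact: is_update_ge0.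
  by rewrite lee_fin ltW// (obs_weight_gt0 _ (y, m)).
- move=> y; rewrite mule_ge0//.
    by apply: V'0 => s; exact: is_update_ge0.
  by rewrite lee_fin ltW// (obs_weight_gt0 _ (y, m)).
- apply: emeasurable_funM.
    rewrite (_ : (fun _ => _) =
      (fun y => V' (is_update H u y sigma)) \o pair^~ m)//.
    by apply: measurableT_comp mV' _; exact: measurable_fun_pair.
  apply: (@measurable_weight _ _ (pair^~ m)).
  exact: measurable_fun_pair.
- have := update_info_state u Ss m; apply: filterS => y Sy.
  by rewrite VV'.
Qed.

Section policy_value.
Variables (N : nat) (mub : is_policy n Q U).
Hypothesis mmub : is_admissible N mub.

(** It is enough to take preimages of the generators [isfun_gen], and these are preimages under the
    parametrized integrals of [measurable_family_section]. *)
Lemma measurable_is_control d (T : measurableType d) (sigma : T -> isfun) k :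
  (k < N)%N -> measurable_family sigma ->
  measurable_fun [set: T] (fun t => mub k (sigma t) : UB).
Proof.
move=> kN fs.
rewrite (_ : (fun _ => _) = (mub k : g_sigma_algebraType (@isfun_gen R n dQ Q) -> UB)
  \o (sigma : T -> g_sigma_algebraType (@isfun_gen R n dQ Q)))//.
apply: measurableT_comp; first exact: mmub.
apply: (@measurability _ _ T (g_sigma_algebraType (@isfun_gen R n dQ Q)) setT
  sigma (@isfun_gen R n dQ Q)) => // _ [_ [q [A [B [mA mB ->]]]] <-].
rewrite setTI.
have := measurable_family_section q fs mA measurableT mB.
by rewrite setTI.
Qed.

(* [policy_value j k sigma] is the value from time [k] on, with [j] steps to
   go, of using [mub] from the information state [sigma]. *)
Fixpoint policy_value (j k : nat) (sigma : isfun) : \bar R :=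
  match j with
  | 0 => pairing sigma K
  | j'.+1 => ref_step H (policy_value j' k.+1) (mub k sigma) sigma
  end.

Lemma policy_value_ge0 j k (sigma : isfun) :
  (forall s, 0 <= sigma s) -> 0 <= policy_value j k sigma.
Proof.
elim: j k sigma => [|j IH] k sigma s0 /=; first exact: pairing_ge0.
by apply: ref_step_ge0 => // ? ?; exact: IH.
Qed.

(** The induction ranges over all families, since a further stage adds the continuous observation to
    the parameter space. *)
Lemma measurable_policy_value j k d (T : measurableType d) (sigma : T -> isfun) :
  (j + k <= N)%N -> measurable_family sigma ->
  measurable_fun [set: T] (fun t => policy_value j k (sigma t)).
Proof.
elim: j k d T sigma => [|j IH] k d T sigma jkN fs /=.
  exact: measurable_pairing.
have [ms s0] := fs.
apply: emeasurable_sum => m; apply: measurable_int_param => [|t y]; last first.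
  rewrite mule_ge0//; last by rewrite lee_fin ltW// (obs_weight_gt0 _ (y, m)).
  by apply: policy_value_ge0 => s; exact: is_update_ge0.
apply: emeasurable_funM; last first.
  apply: (@measurable_weight _ _ (fun z : T * Rn => (z.2, m))).
  exact: measurable_fun_pair.
apply: IH; first by rewrite addnS.
apply: (@measurable_family_update _ _
  (fun z : T * Rn => mub k (sigma z.1)) (fun z => (z.2, m))).
- apply: measurable_is_control; first by apply: leq_trans jkN; rewrite addSn ltnS leq_addl.
  exact: (measurable_family_comp (g := fst) fs).
- exact: measurable_fun_pair.
- exact: (measurable_family_comp (g := fst) fs).
Qed.

Lemma ref_step_policy_value j k u (sigma : isfun) : (j + k <= N)%N ->
  measurable_fun [set: S] sigma -> (forall s, 0 <= sigma s) ->
  ref_step H (policy_value j k) u sigma =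
  \int[nu]_y (policy_value j k (is_update H u y sigma) * (weight y)%:E).
Proof.
move=> jkN ms s0; rewrite integral_sprod_counting//.
- apply: emeasurable_funM; last exact: measurable_weight.
  by apply: measurable_policy_value => //; exact: measurable_family_update1.
- move=> y; rewrite mule_ge0//; last by rewrite lee_fin ltW// obs_weight_gt0.
  by apply: policy_value_ge0 => s; exact: is_update_ge0.
Qed.

Section argsup.
Hypothesis mub_argsup : forall k, (k < N)%N ->
  forall sigma : isfun, info_states sigma ->
  forall u : U, ref_step H (opt_value H N k.+1) u sigma <=
                ref_step H (opt_value H N k.+1) (mub k sigma) sigma.

Lemma ref_step_value_to_go j k u (sigma : isfun) : (j + k <= N)%N ->
  (forall sigma, info_states sigma ->
    value_to_go H j sigma = policy_value j k sigma) ->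
  info_states sigma ->
  ref_step H (value_to_go H j) u sigma = ref_step H (policy_value j k) u sigma.
Proof.
move=> jkN VJ Ss; have [s0 /integrableP[ms _]] := Ss.
apply: eq_ref_step => //.
- exact: value_to_go_ge0.
- exact: policy_value_ge0.
- by apply: measurable_policy_value => //; exact: measurable_family_update1.
Qed.

(** One inequality is the argsup property, the other holds because the control of [mub] competes in
    the supremum. The equation [j + k = N] ties the two indices, since [mub k] is optimal for the
    value with [N - k.+1] further steps to go. *)
Lemma value_to_goE j k (sigma : isfun) : (j + k)%N = N -> info_states sigma ->
  value_to_go H j sigma = policy_value j k sigma.
Proof.
elim: j k sigma => [//|j IH] k sigma jkN Ss.
have jkN' : (j + k.+1)%N = N by rewrite addnS -addSn.
have kN : (k < N)%N by rewrite -jkN addSn ltnS leq_addl.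
have optE : opt_value H N k.+1 = value_to_go H j.
  by rewrite /opt_value -jkN' addnK.
have stepE u : ref_step H (value_to_go H j) u sigma =
    ref_step H (policy_value j k.+1) u sigma.
  apply: ref_step_value_to_go => // [|? ?]; first by rewrite jkN'.
  exact: IH.
rewrite /= -stepE; apply/eqP; rewrite eq_le; apply/andP; split.
  apply: ge_ereal_sup => _ [u _ <-].
  by have := mub_argsup kN Ss u; rewrite optE.
by apply: ereal_sup_ubound; exists (mub k sigma).
Qed.

(** Playing [u] once and returning to [mub] is one of the candidates in the supremum that defines
    [value_to_go]. *)
Lemma policy_value_max j k u (sigma : isfun) : (j.+1 + k)%N = N ->
  info_states sigma ->
  ref_step H (policy_value j k.+1) u sigma <= policy_value j.+1 k sigma.
Proof.
move=> jkN Ss.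
have jkN' : (j + k.+1)%N = N by rewrite addnS -addSn.
rewrite -(value_to_goE jkN Ss) /=; apply: ereal_sup_ubound; exists u => //.
apply: ref_step_value_to_go => // [|? ?]; first by rewrite jkN'.
exact: value_to_goE.
Qed.

(** The expected payoff of following [mu] before time [k] and [mub] from then on. It interpolates
    between the value of [mub] at [k = 0] and the safety of [mu] at [k = N]. *)
Definition closed_value (mu : policy n Q U) k : \bar R :=
  obs_int (fun ys : k.-tuple S =>
    policy_value (N - k) k (eta H k (ys, controls mu ys))).

Lemma measurable_closed_value (mu : policy n Q U) k :
  admissible N mu -> (k <= N)%N ->
  measurable_fun [set: k.-tuple S] (fun ys =>
    policy_value (N - k) k (eta H k (ys, controls mu ys))).
Proof.
move=> mmu kN; apply: (@measurable_policy_value _ _ _ _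
  (fun ys => eta H k (ys, controls mu ys))); first by rewrite subnK.
exact: (measurable_closed_eta mmu kN).
Qed.

Lemma closed_valueS (mu : policy n Q U) k : admissible N mu -> (k < N)%N ->
  closed_value mu k.+1 = obs_int (fun ys : k.-tuple S =>
    ref_step H (policy_value (N - k.+1) k.+1)
      (mu k (ys, controls mu ys)) (eta H k (ys, controls mu ys))).
Proof.
move=> mmu kN; rewrite /closed_value obs_intS//.
- congr obs_int; apply/funext => ys.
  under eq_integral do rewrite controls_tsnoc eta_tsnoc.
  rewrite ref_step_policy_value//.
  + by rewrite subnK.
  + exact: measurable_eta_at.
  + by move=> s; exact: eta_ge0.
- exact: measurable_closed_value.
- by move=> ys; apply: policy_value_ge0 => s; exact: eta_ge0.
Qed.

(** Moving the switching time from [k.+1] down to [k] replaces one control of [mu] by that of [mub],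
    an improvement at almost every observation record by [policy_value_max]. *)
Lemma closed_value_le (mu : policy n Q U) k : admissible N mu -> (k <= N)%N ->
  closed_value mu k <= policy_value N 0 (fun s => (rho s)%:E).
Proof.
move=> mmu; elim: k => [|k IH] kN.
  rewrite /closed_value obs_int0 ?subn0//.
  by have := measurable_closed_value mmu kN; rewrite subn0.
apply: le_trans (IH (ltnW kN)); rewrite closed_valueS//.
have jk : ((N - k.+1).+1 + k)%N = N by rewrite addSnnS subnK.
apply: obs_int_le_ae.
- under eq_fun => ys.
    rewrite ref_step_policy_value; first over.
    + by rewrite subnK.
    + exact: measurable_eta_at.
    + by move=> s; exact: eta_ge0.
  apply: measurable_int_param => [|ys y]; last first.
    rewrite mule_ge0//; last by rewrite lee_fin ltW// obs_weight_gt0.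
    apply: policy_value_ge0 => s; apply: is_update_ge0 => s'; exact: eta_ge0.
  apply: emeasurable_funM; last exact: measurable_weight.
  apply: measurable_policy_value; first by rewrite subnK.
  apply: (@measurable_family_update _ _
    (fun z : k.-tuple S * S => @mu k (z.1, controls mu z.1)) snd) => //.
    exact: measurableT_comp (measurable_control mmu kN) measurable_fst.
  exact: (measurable_family_comp (g := fst)
    (measurable_closed_eta mmu (ltnW kN))).
- exact: measurable_closed_value (ltnW kN).
- move=> ys; apply: ref_step_ge0 => [? ?|s]; last exact: eta_ge0.
  exact: policy_value_ge0.
- by move=> ys; apply: policy_value_ge0 => s; exact: eta_ge0.
- have := closed_eta_info_state mmu (ltnW kN); apply: filterS => ys Sys.
  by rewrite -(subnSK kN); exact: policy_value_max.
Qed.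

Lemma closed_value_policy_of k : admissible N (policy_of H mub) -> (k <= N)%N ->
  closed_value (policy_of H mub) k = policy_value N 0 (fun s => (rho s)%:E).
Proof.
move=> mmu; elim: k => [|k IH] kN.
  rewrite /closed_value obs_int0 ?subn0//.
  by have := measurable_closed_value mmu kN; rewrite subn0.
by rewrite -(IH (ltnW kN)) closed_valueS// /closed_value -(subnSK kN).
Qed.

End argsup.

Lemma admissible_policy_of : admissible N (policy_of H mub).
Proof.
by move=> k kN; apply: measurable_is_control => //; exact: measurable_eta.
Qed.

End policy_value.

(** * From state trajectories to the filter *)

Definition safe_before k (ss : k.+1.-tuple S) : R :=
  (\prod_(i < k) \1_K (tnth ss (widen_ord (leqnSn k) i)))%R.

(** An update tests the state it leaves, so the final state is excluded from [safe_before] and its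
    test is left to the pairing; appending a state brings in the test of the one before. *)
Lemma safe_before_tsnoc k (ss : k.+1.-tuple S) s' :
  safe_before (tsnoc (ss, s')) = (safe_before ss * \1_K (tnth ss ord_max))%R.
Proof.
rewrite /safe_before big_ord_recr/= tsnoc_widen; congr (_ * _)%R.
by apply: eq_bigr => l _; rewrite tsnoc_widen.
Qed.

Lemma safe_before_ge0 k (ss : k.+1.-tuple S) : (0 <= safe_before ss)%R.
Proof. exact: prodr_ge0. Qed.

Lemma traj_dens_tsnoc k (us : k.-tuple UB) (u : UB) (ss : k.+1.-tuple S) s'
    (ys : k.-tuple S) y :
  traj_dens H (tsnoc (us, u)) (tsnoc (ss, s'), tsnoc (ys, y)) =
  (traj_dens H us (ss, ys) * step u y s' (tnth ss ord_max))%R.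
Proof.
rewrite /traj_dens tsnoc_ord0 -mulrA big_ord_recr/=; congr (_ * (_ * _))%R.
  by apply: eq_bigr => l _; rewrite lift0_widen !tsnoc_widen (tsnoc_widen us u).
by rewrite lift0_max !tsnoc_widen !tsnoc_max (tsnoc_max us u).
Qed.

Lemma traj_dens_ge0 k (us : k.-tuple U) (w : traj R n Q k) :
  (0 <= traj_dens H us w)%R.
Proof.
case: w => ss ys; rewrite mulr_ge0 ?init_dens_ge0// prodr_ge0// => l _.
exact: step_dens_ge0.
Qed.

Section families.
Context d (T : measurableType d) (k : nat).
Context (us : T -> k.-tuple UB) (ss : T -> k.+1.-tuple S) (ys : T -> k.-tuple S).
Hypothesis mus : measurable_fun [set: T] us.
Hypothesis mss : measurable_fun [set: T] ss.
Hypothesis mys : measurable_fun [set: T] ys.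

Let mtnth j dV (V : measurableType dV) (x : T -> j.-tuple V) i :
  measurable_fun [set: T] x -> measurable_fun [set: T] (fun t => tnth (x t) i).
Proof. by move=> mx; exact: measurableT_comp (measurable_tnth i) mx. Qed.

Lemma measurable_traj_dens :
  measurable_fun [set: T] (fun t => traj_dens H (us t) (ss t, ys t)).
Proof.
apply: measurable_funM.
  exact: measurableT_comp (measurable_init_dens H) (mtnth _ mss).
apply: measurable_prod => l _.
by apply: measurable_step_dens; exact: mtnth.
Qed.

Lemma measurable_safe_before :
  measurable_fun [set: T] (fun t => safe_before (ss t)).
Proof.
apply: measurable_prod => l _.
rewrite (_ : (fun _ => _) =
  (\1_K : S -> R) \o (fun t => tnth (ss t) (widen_ord (leqnSn k) l)))//.
apply: measurableT_comp; last exact: mtnth.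
by apply: measurable_indic; exact: measurable_safe.
Qed.

End families.

Lemma measurable_path_integrand k (us : k.-tuple UB) (ys : k.-tuple S)
    (g : S -> \bar R) : measurable_fun [set: S] g ->
  measurable_fun [set: k.+1.-tuple S] (fun ss =>
    g (tnth ss ord_max) * (safe_before ss * traj_dens H us (ss, ys))%:E).
Proof.
move=> mg; apply: emeasurable_funM.
  exact: measurableT_comp mg (measurable_tnth _).
apply/measurable_EFinP; apply: measurable_funM.
  exact: (@measurable_safe_before _ _ _ id).
exact: (@measurable_traj_dens _ _ _ (cst us) id (cst ys)).
Qed.

(* Integrating the density of the states and observations over the states
   leaves the filter: this is the recursion for [eta], unrolled. *)
Lemma path_integral k (us : k.-tuple UB) (ys : k.-tuple S) (g : S -> \bar R) :
  measurable_fun [set: S] g -> (forall s, 0 <= g s) ->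
  \int[mpow nu k.+1]_ss
    (g (tnth ss ord_max) * (safe_before ss * traj_dens H us (ss, ys))%:E) =
  (\int[nu]_s (g s * eta H k (ys, us) s)) * (obs_weights ys)%:E.
Proof.
elim: k us ys g => [|k IH] us ys g mg g0.
  rewrite integral_mpow1; last 2 first.
  - exact: measurable_path_integrand.
  - move=> ss; rewrite mule_ge0// lee_fin.
    by rewrite mulr_ge0 ?safe_before_ge0 ?traj_dens_ge0.
  rewrite /obs_weights big_ord0 mule1; apply: eq_integral => s _.
  rewrite tsnoc_max /safe_before big_ord0 mul1r /traj_dens big_ord0 mulr1.
  rewrite (_ : ord0 = ord_max); last exact: val_inj.
  by rewrite tsnoc_max /eta (tuple0 ys) (tuple0 us).
rewrite -[us](@tunsnocK _ UB) -[ys]tunsnocK.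
case: (@tunsnoc _ UB _ us) => {}us u; case: (tunsnoc ys) => {}ys y.
rewrite integral_mpowS; last 2 first.
- exact: measurable_path_integrand.
- move=> ss; rewrite mule_ge0// lee_fin.
  by rewrite mulr_ge0 ?safe_before_ge0 ?traj_dens_ge0.
pose f s s' := g s' * (\1_K s * step u y s' s)%:E.
have f0 s s' : 0 <= f s s'.
  by rewrite mule_ge0// lee_fin mulr_ge0// step_dens_ge0.
have mf : measurable_fun [set: S * S] (fun z => f z.1 z.2).
  apply: emeasurable_funM; first exact: measurableT_comp mg measurable_snd.
  apply/measurable_EFinP; apply: measurable_funM; last first.
    exact: (@measurable_step_dens _ _ _ _ _ H _ _ (cst u) (cst y)).
  rewrite (_ : (fun _ => _) = (\1_K : S -> R) \o fst)//.
  apply: measurableT_comp => //.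
  by apply: measurable_indic; exact: measurable_safe.
have mfs s : measurable_fun [set: S] (f s).
  rewrite (_ : f s = (fun z => f z.1 z.2) \o pair s)//.
  by apply: measurableT_comp mf _; exact: measurable_fun_pair.
(* Integrating out the last state pulls the test function back by one step. The induction hypothesis
   is applied to [g'], which is why it is quantified over test functions. *)
pose g' s := \int[nu]_s' f s s'.
have mg' : measurable_fun [set: S] g' by exact: measurable_int_param.
have g'0 s : 0 <= g' s by exact: integral_ge0.
rewrite (_ : \int[_]_ss _ = \int[mpow nu k.+1]_ss
    (g' (tnth ss ord_max) * (safe_before ss * traj_dens H us (ss, ys))%:E));
    last first.
  apply: eq_integral => ss _; rewrite -ge0_integralZr//; last first.
    by rewrite lee_fin mulr_ge0 ?safe_before_ge0 ?traj_dens_ge0.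
  apply: eq_integral => s' _.
  rewrite tsnoc_max safe_before_tsnoc traj_dens_tsnoc /f -muleA -EFinM.
  by congr (_ * _%:E); rewrite mulrACA mulrC.
rewrite IH// obs_weights_tsnoc [X in _ = _ * X%:E]mulrC EFinM muleA.
congr (_ * _).
have me : measurable_fun [set: S * S] (fun z => f z.1 z.2 * eta H k (ys, us) z.1).
  apply: emeasurable_funM => //.
  exact: measurableT_comp (measurable_eta_at (ys, us)) measurable_fst.
rewrite -[RHS]ge0_integralZr//; last 3 first.
- apply: emeasurable_funM => //.
  exact: (measurable_eta_at (tsnoc (ys, y), tsnoc (us, u))).
- by move=> s _; rewrite mule_ge0// eta_ge0.
- by rewrite lee_fin ltW// obs_weight_gt0.
(* By duality, exchanging [s] and [s'] moves the one-step kernel from the test function to the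
   information state, where it becomes the update. *)
transitivity (\int[nu]_s \int[nu]_s' (f s s' * eta H k (ys, us) s)).
  apply: eq_integral => s _; rewrite ge0_integralZr//; exact: eta_ge0.
rewrite integral_swap//; last by move=> s s'; rewrite mule_ge0// eta_ge0.
apply: eq_integral => s' _.
rewrite eta_tsnoc -muleA is_update_weight; last 2 first.
- exact: (measurable_eta_at (ys, us)).
- by move=> s; exact: eta_ge0.
rewrite -ge0_integralZl//.
- by apply: eq_integral => s _; rewrite /f muleA.
- apply: emeasurable_funM; last exact: (measurable_eta_at (ys, us)).
  apply/measurable_EFinP; apply: measurable_funM.
    by apply: measurable_indic; exact: measurable_safe.
  exact: (@measurable_step_dens _ _ _ _ _ H _ _ (cst u) (cst y) (cst s') id).
- move=> s _; rewrite mule_ge0 ?eta_ge0// lee_fin.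
  by rewrite mulr_ge0// step_dens_ge0.
Qed.

(** * The reference law *)

Definition state_dens k (us : k.-tuple U) (ss : k.+1.-tuple S) : R :=
  (rho (tnth ss ord0) * \prod_(l < k)
    tau (tnth ss (lift ord0 l)) (tnth ss (widen_ord (leqnSn k) l)) (tnth us l))%R.

Lemma likelihood_gt0 k (us : k.-tuple U) (w : traj R n Q k) :
  (0 < likelihood H us w)%R.
Proof.
case: w => ss ys; apply: prodr_gt0 => l _.
by rewrite divr_gt0 ?mulr_gt0 ?invr_gt0 ?noise_gt0 ?confusion_gt0 ?card_modes_gt0.
Qed.

(** Dividing by the likelihood ratio splits the joint density: the observations become independent
    of each other and of the states, given the controls. *)
Lemma traj_dens_likelihood k (us : k.-tuple U) (w : traj R n Q k) :
  (traj_dens H us w / likelihood H us w)%R =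
  (state_dens us w.1 * obs_weights w.2)%R.
Proof.
case: w => ss ys; rewrite /traj_dens /likelihood /state_dens /obs_weights /=.
rewrite -!mulrA; congr (_ * _)%R; rewrite -prodf_div -big_split/=.
apply: eq_bigr => l _.
set a := (noise _ _ * confusion _ _ _ _)%R.
rewrite -mulrA; congr (_ * _)%R; rewrite invf_div mulrCA mulfV ?mulr1.
  by rewrite mulrC.
by rewrite gt_eqF// mulr_gt0 ?noise_gt0 ?confusion_gt0.
Qed.

Lemma state_dens_ge0 k (us : k.-tuple U) ss : (0 <= state_dens us ss)%R.
Proof.
rewrite mulr_ge0 ?init_dens_ge0// prodr_ge0// => l _; exact: trans_dens_ge0.
Qed.

(** Transitions are known to have total mass 1 only from [cspace]; this settles the other sources in
    [state_dens_int], where both sides vanish. *)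
Lemma state_dens_out k (us : k.-tuple U) (ss : k.+1.-tuple S) :
  ~ cspace H (tnth ss ord_max).1 -> state_dens us ss = 0%R.
Proof.
rewrite /state_dens; case: k us ss => [|k] us ss out.
  by rewrite (_ : ord0 = ord_max) ?init_dens_out ?mul0r//; exact: val_inj.
by rewrite big_ord_recr/= lift0_max trans_dens_out// !mulr0.
Qed.

Lemma state_dens_tsnoc k (us : k.-tuple UB) (u : UB) (ss : k.+1.-tuple S) s' :
  state_dens (tsnoc (us, u)) (tsnoc (ss, s')) =
  (state_dens us ss * tau s' (tnth ss ord_max) u)%R.
Proof.
rewrite /state_dens tsnoc_ord0 -mulrA big_ord_recr/=; congr (_ * (_ * _))%R.
  by apply: eq_bigr => l _; rewrite lift0_widen !tsnoc_widen (tsnoc_widen us u).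
by rewrite lift0_max !tsnoc_widen !tsnoc_max (tsnoc_max us u).
Qed.

Lemma measurable_state_dens d (T : measurableType d) k (us : T -> k.-tuple UB)
    (ss : T -> k.+1.-tuple S) :
  measurable_fun [set: T] us -> measurable_fun [set: T] ss ->
  measurable_fun [set: T] (fun t => state_dens (us t) (ss t)).
Proof.
move=> mus mss; apply: measurable_funM.
  apply: measurableT_comp (measurable_init_dens H) _.
  exact: measurableT_comp (measurable_tnth _) mss.
apply: measurable_prod => l _; apply: measurable_trans.
- exact: measurableT_comp (measurable_tnth _) mus.
- exact: measurableT_comp (measurable_tnth _) mss.
- exact: measurableT_comp (measurable_tnth _) mss.
Qed.

Lemma state_dens_int k (us : k.-tuple UB) :
  \int[mpow nu k.+1]_ss (state_dens us ss)%:E = 1.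
Proof.
have ms j (vs : j.-tuple UB) :
    measurable_fun setT (fun ss => (state_dens vs ss)%:E).
  by apply/measurable_EFinP; exact: (@measurable_state_dens _ _ _ (cst vs) id).
have s0 j (vs : j.-tuple UB) ss : 0 <= (state_dens vs ss)%:E.
  by rewrite lee_fin state_dens_ge0.
elim: k us => [|k IH] us.
  rewrite integral_mpow1// -(init_dens_int H) integral_sprod_counting//; last first.
    rewrite (_ : (fun _ => _) = (fun ss => (state_dens us ss)%:E) \o
      @tsnoc _ S 0 \o pair [tuple])//.
    apply: measurableT_comp; last exact: measurable_fun_pair.
    exact: measurableT_comp (ms _ us) (@measurable_tsnoc _ _ _).
  apply: eq_bigr => q _; apply: eq_integral => x _.
  rewrite /state_dens big_ord0 mulr1 (_ : ord0 = ord_max) ?tsnoc_max//.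
  exact: val_inj.
rewrite -[us](@tunsnocK _ UB); case: (@tunsnoc _ UB _ us) => {}us u.
rewrite integral_mpowS// -[RHS](IH us); apply: eq_integral => ss _.
under eq_integral do rewrite state_dens_tsnoc EFinM.
rewrite ge0_integralZl//; last 2 first.
- apply/measurable_EFinP.
  exact: (@measurable_trans _ _ _ _ _ H _ _ (cst u) id (cst (tnth ss ord_max))).
- by move=> s' _; rewrite lee_fin trans_dens_ge0.
case: (pselect (cspace H (tnth ss ord_max).1)) => [Css|/state_dens_out->].
  by rewrite trans_dens_int// mule1.
by rewrite mul0e.
Qed.

(** The observations are put outside because they determine the controls, which are then constant in
    the integral over the states. *)
Lemma integral_traj k (f : traj R n Q k -> \bar R) :
  measurable_fun [set: k.+1.-tuple S * k.-tuple S] f -> (forall w, 0 <= f w) ->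
  \int[traj_measure R n Q k]_w f w =
  \int[mpow nu k]_ys \int[mpow nu k.+1]_ss f (ss, ys).
Proof.
move=> mf f0; rewrite integral_sprod//.
rewrite (@integral_swap _ _ _ _ _ _ _ (fun ss ys => f (ss, ys)))//.
by rewrite (_ : (fun _ => _) = f)//; apply/funext => -[].
Qed.

Lemma eta_zipS k (ys : k.+1.-tuple S) (us : k.-tuple UB) (u : UB) :
  eta H k.+1 (ys, tsnoc (us, u)) =
  is_update H u (tnth ys ord_max) (eta H k (tinit ys, us)).
Proof. by rewrite -{1}[ys]tunsnocK eta_tsnoc. Qed.

Lemma closed_loopE (mub : is_policy n Q U) k (ys : k.-tuple S) :
  closed_loop H mub ys =
  (eta H k (ys, controls (policy_of H mub) ys), controls (policy_of H mub) ys).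
Proof.
elim: k ys => [|k IH] ys.
  by rewrite /eta (tuple0 ys).
by rewrite /= IH (@eta_zipS _ _ (controls _ (tinit ys) : k.-tuple UB)).
Qed.

(** * Safety and conditional densities of an admissible policy *)

Section admissible_policy.
Variables (N : nat) (mu : policy n Q U).
Hypothesis mmu : admissible N mu.

Let mc k : (k <= N)%N ->
  measurable_fun [set: k.-tuple S] (controls mu (k := k) : _ -> k.-tuple UB).
Proof.
move=> kN.
exact: measurableT_comp measurable_snd (measurable_info_controls mmu kN).
Qed.

(** The common source of the safety formula and of the conditional density property, which differ in
    the test function [g]. *)
Lemma integral_traj_eta k (g : k.-tuple S -> S -> \bar R) : (k <= N)%N ->
  measurable_fun [set: k.-tuple S * S] (fun z => g z.1 z.2) ->
  (forall ys s, 0 <= g ys s) ->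
  \int[traj_measure R n Q k]_w (g w.2 (tnth w.1 ord_max) *
    (safe_before w.1 * traj_dens H (controls mu w.2) w)%:E) =
  obs_int (fun ys =>
    \int[nu]_s (g ys s * eta H k (ys, controls mu ys) s)).
Proof.
move=> kN mg g0; rewrite integral_traj.
- apply: eq_integral => ys _ /=; rewrite path_integral//.
  rewrite (_ : g ys = (fun z => g z.1 z.2) \o pair ys)//.
  by apply: measurableT_comp mg _; exact: measurable_fun_pair.
- apply: emeasurable_funM.
    rewrite (_ : (fun _ => _) = (fun z => g z.1 z.2) \o
      (fun w : k.+1.-tuple S * k.-tuple S => (w.2, tnth w.1 ord_max)))//.
    apply: measurableT_comp mg _; apply: measurable_fun_pair => //.
    exact: measurableT_comp (measurable_tnth _) measurable_fst.
  apply/measurable_EFinP; apply: measurable_funM.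
    exact: measurable_safe_before.
  under eq_fun do rewrite [X in traj_dens _ _ X]surjective_pairing.
  apply: measurable_traj_dens => //.
  exact: measurableT_comp (mc kN) measurable_snd.
- move=> w; rewrite mule_ge0// lee_fin.
  by rewrite mulr_ge0 ?safe_before_ge0 ?traj_dens_ge0.
Qed.

Lemma safetyE : safety H N mu =
  obs_int (fun ys => pairing (eta H N (ys, controls mu ys)) K).
Proof.
rewrite /safety /traj_prob integral_mkcond.
rewrite (_ : \int[_]_w _ = \int[traj_measure R n Q N]_w
  ((\1_K (tnth w.1 ord_max))%:E *
    (safe_before w.1 * traj_dens H (controls mu w.2) w)%:E)).
  rewrite (integral_traj_eta (g := fun _ s => (\1_K s)%:E))//.
  - congr obs_int; apply/funext => ys; rewrite pairingE.
    + by apply: eq_integral => s _; rewrite muleC.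
    + exact: measurable_eta_at.
    + by move=> s; exact: eta_ge0.
  - apply/measurable_EFinP.
    rewrite (_ : (fun _ => _) = (\1_K : S -> R) \o snd)//.
    apply: measurableT_comp => //.
    by apply: measurable_indic; exact: measurable_safe.
apply: eq_integral => w _; rewrite patchE -EFinM mulrA.
(* The event covers times 0 to [N]: [safe_before] accounts for those before [N], and the test
   function for time [N] itself. *)
have -> : (\1_K (tnth w.1 ord_max) * safe_before w.1)%R =
    (\prod_(i < N.+1) \1_K (tnth w.1 i))%R.
  by rewrite big_ord_recr/= mulrC.
case: ifPn => [/set_mem/= Kw|/negP nKw].
  by rewrite big1 ?mul1r// => i _; rewrite indicE mem_set//; exact: Kw.
have [i nKi] : exists i, ~ K (tnth w.1 i).
  by apply/existsNP => Kw; apply: nKw; apply/mem_set.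
by rewrite (bigD1 i)//= indicE memNset// !mul0r.
Qed.

(** For each observation record the controls are fixed and the state density integrates to 1, so
    only the observation weights remain. *)
Lemma ref_expectation_obs k (G : k.-tuple S -> \bar R) : (k <= N)%N ->
  measurable_fun setT G -> (forall ys, 0 <= G ys) ->
  ref_expectation H (controls mu (k := k)) (fun w => G w.2) = obs_int G.
Proof.
move=> kN mG G0; rewrite /ref_expectation.
rewrite (_ : \int[_]_w _ = \int[traj_measure R n Q k]_w
  (G w.2 * (obs_weights w.2)%:E * (state_dens (controls mu w.2) w.1)%:E)).
  rewrite integral_traj; first last.
  - move=> w; rewrite !mule_ge0// lee_fin ?state_dens_ge0//.
    by rewrite ltW// obs_weights_gt0.
  - apply: emeasurable_funM.
      apply: emeasurable_funM; first exact: measurableT_comp mG measurable_snd.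
      rewrite (_ : (fun _ => _) = (fun ys => (obs_weights ys)%:E) \o snd)//.
      by apply: measurableT_comp => //; exact: measurable_obs_weights.
    apply/measurable_EFinP; apply: measurable_state_dens => //.
    exact: measurableT_comp (mc kN) measurable_snd.
  apply: eq_integral => ys _ /=.
  rewrite ge0_integralZl//; first by rewrite state_dens_int mule1.
  - apply/measurable_EFinP.
    exact: (@measurable_state_dens _ _ _ (cst (controls mu ys)) id).
  - by move=> ss _; rewrite lee_fin state_dens_ge0.
  - by rewrite mule_ge0// lee_fin ltW// obs_weights_gt0.
apply: eq_integral => w _.
by rewrite traj_dens_likelihood mulrC EFinM muleA.
Qed.

(** On the left the integrand depends on the observations only. On the right the likelihood cancels
    the denominator of the reference density, which leaves the actual joint density, to be tested
    against the indicators of [B], [q] and [A] through [integral_traj_eta]. *)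
Lemma unnormalized_cond_density_eta k : (k <= N)%N ->
  unnormalized_cond_density H mu (eta H k).
Proof.
move=> kN c q A mA; split.
  exact: measurable_family_section (measurable_eta k) mA.
move=> B mB.
pose i (ys : k.-tuple S) : k.-tuple S * k.-tuple UB := (ys, c ys).
have mi : measurable_fun setT i := measurable_info_controls mmu kN.
have m1B : measurable_fun setT (fun ys => (\1_B (i ys))%:E : \bar R).
  apply/measurable_EFinP.
  rewrite (_ : (fun _ => _) = (\1_B : _ -> R) \o i)//.
  by apply: measurableT_comp mi; exact: measurable_indic.
have mI : measurable_fun setT (fun ys => \int[leb]_(x in A) eta H k (i ys) (x, q)).
  exact: (measurable_family_section q (measurable_closed_eta mmu kN) mA).
rewrite (ref_expectation_obs (G := fun ys =>
  (\1_B (i ys))%:E * \int[leb]_(x in A) eta H k (i ys) (x, q)))//; last 2 first.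
- exact: emeasurable_funM.
- move=> ys; rewrite mule_ge0// ?lee_fin//.
  by apply: integral_ge0 => x _; exact: eta_ge0.
pose g (s : S) : R := ((s.2 == q)%:R * \1_A s.1)%R.
have g0 s : (0 <= g s)%R by rewrite mulr_ge0.
have mg : measurable_fun [set: S] g.
  apply: measurable_fun_prod_discrete => q'; apply: measurable_funM => /=.
    exact: measurable_cst.
  exact: measurable_indic.
rewrite /ref_expectation.
rewrite (_ : \int[_]_w _ = \int[traj_measure R n Q k]_w
  ((\1_B (i w.2) * g (tnth w.1 ord_max))%:E *
   (safe_before w.1 * traj_dens H (c w.2) w)%:E)); last first.
  apply: eq_integral => w _; rewrite -!EFinM; congr EFin.
  rewrite -!mulrA; do 3 congr (_ * _)%R; congr (_ * _)%R.
  by rewrite mulrCA mulfV ?mulr1// gt_eqF// likelihood_gt0.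
rewrite (integral_traj_eta (g := fun ys s => (\1_B (i ys) * g s)%:E))//.
- congr obs_int; apply/funext => ys.
  have me : measurable_fun [set: S] (eta H k (i ys)) by exact: measurable_eta_at.
  have mge : measurable_fun [set: S] (fun s => (g s)%:E * eta H k (i ys) s).
    by apply: emeasurable_funM => //; exact/measurable_EFinP.
  under [RHS]eq_integral do rewrite EFinM -muleA.
  rewrite ge0_integralZl//; last by move=> s _; rewrite mule_ge0 ?eta_ge0// lee_fin.
  congr (_ * _); rewrite integral_sprod_counting//; last first.
    by move=> s; rewrite mule_ge0 ?eta_ge0// lee_fin.
  rewrite (bigD1 q)//= [X in _ + X]big1 ?adde0 => [|q' q'q].
    rewrite integral_mkcond; apply: eq_integral => x _.
    by rewrite /g/= eqxx mul1r epatch_indic muleC.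
  by apply: integral0_eq => x _; rewrite /g/= (negbTE q'q) mul0r mul0e.
- apply/measurable_EFinP; apply: measurable_funM.
    exact: measurableT_comp ((measurable_EFinP _ _).1 m1B) measurable_fst.
  exact: measurableT_comp mg measurable_snd.
- by move=> ys s; rewrite lee_fin mulr_ge0.
Qed.

End admissible_policy.

End information_state_control.

Theorem theorem8 (R : realType) (n : nat) (dQ : measure_display)
    (Q : finDiscreteType dQ) (U : pseudoPMetricType R)
    (U_compact : compact [set: U]) (U_hausdorff : hausdorff_space U)
    (H : hybrid_system n Q U) (N : nat) (mub : is_policy n Q U)
    (mub_measurable : is_admissible N mub)
    (mub_argsup : forall k, (k < N)%N ->
       forall sigma : isfun R n Q, info_states sigma ->
       forall u : U,
         (ref_step H (opt_value H N k.+1) u sigma <=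
          ref_step H (opt_value H N k.+1) (mub k sigma) sigma)%E) :
  let mu : policy n Q U := policy_of H mub in
  [/\ admissible N mu,
      forall mu' : policy n Q U, admissible N mu' ->
        (safety H N mu' <= safety H N mu)%E,
      forall k (ys : k.-tuple ('rV[R]_n * Q)%type), (k <= N)%N ->
        closed_loop H mub ys = (eta H k (ys, controls mu ys), controls mu ys),
      forall mu' : policy n Q U, admissible N mu' ->
        forall k, (k <= N)%N ->
        unnormalized_cond_density H mu' (eta H k) &
      is_safety H N mub =
        ereal_sup [set safety H N mu' | mu' in [set mu' | admissible N mu']] /\
      ereal_sup [set safety H N mu' | mu' in [set mu' | admissible N mu']] =
        safety H N mu].
Proof.
move=> mu.
have mmu : admissible N mu by exact: admissible_policy_of.
have terminal mu' : admissible N mu' ->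
    safety H N mu' = closed_value H N mub mu' N.
  by move=> mmu'; rewrite (safetyE H mmu') /closed_value subnn.
have best mu' : admissible N mu' -> (safety H N mu' <= safety H N mu)%E.
  move=> mmu'; rewrite !terminal//.
  rewrite (closed_value_policy_of mub_measurable mmu (leqnn N)).
  exact: closed_value_le.
have supE : ereal_sup [set safety H N mu' | mu' in [set mu' | admissible N mu']]
    = safety H N mu.
  apply/eqP; rewrite eq_le; apply/andP; split.
    by apply: ge_ereal_sup => _ [mu' mmu' <-]; exact: best.
  by apply: ereal_sup_ubound; exists mu.
split => //.
- by move=> k ys _; exact: closed_loopE.
- by move=> mu' mmu' k kN; exact: (unnormalized_cond_density_eta H mmu' kN).
split => //; rewrite supE (safetyE H mmu) /is_safety.
(* The payoff of the closed loop is a function of the observations alone, so its reference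
   expectation is the integral given by [safetyE]. *)
rewrite -(ref_expectation_obs H mmu (leqnn N)).
- congr ref_expectation; first by apply/funext => ys; rewrite closed_loopE.
  by apply/funext => w; rewrite closed_loopE.
- apply: measurable_pairing; exact: (measurable_closed_eta H mmu (leqnn N)).
- by move=> ys; apply: pairing_ge0 => s; exact: eta_ge0.
Qed.
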